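(* Let $K$ be a field, let $(Q,I)$ be a gentle quiver (with $KQ/I$ finite-dimensional), let $Sp$ be an admissible set of special vertices of $(Q,I)$, and let $\hat A=K\hat Q/\hat I$ be the skewed-gentle algebra arising from the skewed-gentle triple $(Q,Sp,I)$. For $k\ge1$ denote by $c_k$ the number of minimal oriented $k$-cycles in $Q$ with full zero relations (with respect to $I$). Then the $q$-Cartan matrix $C_{\hat A}(q)$ is unimodularly equivalent over $\mathbb{Z}[q]$ to a diagonal matrix in which, for each $k\ge 1$, the entry $1-(-q)^k$ occurs with multiplicity $c_k$, and all further diagonal entries are $1$.
   Context: A quiver $Q$ is a finite directed graph (loops and multiple arrows allowed) with vertex set $Q_0$; for an arrow $\alpha$, $s(\alpha)$ is its start vertex and $t(\alpha)$ its end vertex. Paths are read from left to right: an oriented path of length $r\ge 1$ is a sequence $\alpha_1\alpha_2\cdots\alpha_r$ of arrows with $t(\alpha_i)=s(\alpha_{i+1})$, and each vertex $v$ has a trivial path $e_v$ of length $0$. The path algebra $KQ$ has all oriented paths as $K$-basis, and multiplication is concatenation (zero if the paths cannot be concatenated). An ideal $I\subset KQ$ is admissible if $I\subseteq J^2$, where $J$ is the ideal generated by the arrows. A pair $(Q,I)$ with $I$ an admissible ideal of $KQ$ is a gentle quiver if: (i) each vertex is the start point of at most two arrows and the end point of at most two arrows; (ii) for each arrow $\alpha$ there is at most one arrow $\beta$ with $\alpha\beta\notin I$ and at most one arrow $\gamma$ with $\gamma\alpha\notin I$; (iii) $I$ is generated by paths of length $2$; (iv) for each arrow $\alpha$ there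 is at most one arrow $\beta'$ with $t(\alpha)=s(\beta')$ and $\alpha\beta'\in I$, and at most one arrow $\gamma'$ with $t(\gamma')=s(\alpha)$ and $\gamma'\alpha\in I$. Finite-dimensionality of $KQ/I$ is always assumed for gentle quivers. The valency of a vertex is the number of incoming arrows plus the number of outgoing arrows (a loop counts twice). A set $Sp\subseteq Q_0$ is an admissible set of special vertices of $(Q,I)$ if the pair $(Q^{\mathrm{sp}},I^{\mathrm{sp}})$, obtained from $(Q,I)$ by adding at each $v\in Sp$ a loop $\varepsilon_v$ with the additional relation $\varepsilon_v^2=0$ (all other relations remaining those of $I$), is again gentle, with $KQ^{\mathrm{sp}}/I^{\mathrm{sp}}$ again finite-dimensional (no nonzero paths of arbitrary length). Then $(Q,Sp,I)$ is called a skewed-gentle triple. (In particular a special vertex has valency $0$ or $1$, or valency $2$ with a zero relation at it not coming from a loop.) Given a skewed-gentle triple $(Q,Sp,I)$, the quiver with relations $(\hat Q,\hat I)$ is constructed as follows. Non-special vertices of $Q$ are vertices of $\hat Q$; each $v\in Sp$ is replaced by two vertices $v^+,v^-$. Arrows between non-special vertices are kept. An arrow $a$ from a non-special vertex $w$ to a special vertex $v$ (resp. from $v$ to $w$) is replaced by two arrows $a^{\pm}:w\to v^{\pm}$ (resp. $a^{\pm}:v^{\pm}\to w$); an arrow between two special vertices $v,w$ is replaced by four arrows, one between each of $v^{\pm}$ and each of $w^{\pm}$ (in the same direction). The new arrows are said to lie over $a$. The ideal $\hat I$ is generated by: for every relation $ab\in I$ (with $a,b$ arrows, $t(a)=s(b)$)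 such that $t(a)$ is non-special, all paths of length $2$ lying over $ab$; and for every special vertex $v$ of valency $2$ in $Q$ with its zero relation $ab\in I$, $t(a)=v=s(b)$, all differences of two paths of length $2$ lying over $ab$ which have the same start and end points and run through $v^+$ and $v^-$, respectively (mesh commutation relations). The $q$-Cartan matrix of a finite-dimensional algebra $A=KQ/I$ with $I$ generated by homogeneous relations (linear combinations of paths of the same length) is the $|Q_0|\times|Q_0|$ matrix $C_A(q)=(c_{ij}(q))$ over $\mathbb{Z}[q]$, $q$ an indeterminate, with $c_{ij}(q)=\sum_n \dim_K (e_iAe_j)_n\,q^n$, where $e_iAe_j=\bigoplus_n (e_iAe_j)_n$ is the grading induced by path length. (For $\hat A$ the same definition is used with $(\hat Q,\hat I)$.) An oriented $k$-cycle with full zero relations ($k\ge1$) in $(Q,I)$ is an oriented path $p=p_0p_1\cdots p_{k-1}$ with arrows $p_0,\dots,p_{k-1}$ in $Q$ having the same start and end point and such that $p_ip_{i+1}\in I$ for $i=0,\dots,k-2$ and $p_{k-1}p_0\in I$. It is minimal if $p_0,\dots,p_{k-1}$ are pairwise different arrows. Such cycles are counted up to cyclic rotation (choice of starting point). Two square matrices $C,D$ over $\mathbb{Z}[q]$ are unimodularly equivalent (over $\mathbb{Z}[q]$) if there are matrices $P,P'$ over $\mathbb{Z}[q]$ of determinant $1$ with $D=PCP'$. *)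

(* Defs.v *)
From HB Require Import structures.
From mathcomp Require Import all_boot all_order all_algebra finmap.
From mathcomp Require Import boolp classical_sets monalg.

Set Implicit Arguments.
Unset Strict Implicit.
Unset Printing Implicit Defensive.

Import GRing.Theory.

Local Open Scope ring_scope.
Local Open Scope classical_set_scope.

Record quiver := Quiver {
  vertex : finType;
  arrow : finType;
  src : arrow -> vertex;
  tgt : arrow -> vertex
}.

Section Paths.
Variable Q : quiver.

Fixpoint is_walk (v : vertex Q) (s : seq (arrow Q)) : bool :=
  if s is a :: s' then (src a == v) && is_walk (tgt a) s' else true.

Definition walk_end (v : vertex Q) (s : seq (arrow Q)) : vertex Q :=
  last v (map (@tgt Q) s).

(* [(v, [::])] is the trivial path [e_v]; the start vertex of a path of
   positive length is redundant. *)
Record qpath := QPath {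
  qpath_val : vertex Q * seq (arrow Q);
  _ : is_walk qpath_val.1 qpath_val.2
}.

HB.instance Definition _ := [isSub for qpath_val].

(* The equality and choice operators of [qpath] are opaque: unification is
   unusably slow in [{malg K[qpath]}] when it can unfold them. *)
Fact qpath_decEq : hasDecEq qpath.
Proof.
exact: (Equality.eqtype_hasDecEq_mixin (Equality.class (sub_type qpath))).
Qed.
HB.instance Definition _ := qpath_decEq.

Fact qpath_choice : hasChoice qpath.
Proof.
exact: (Choice.choice_hasChoice_mixin (Choice.class (sub_type qpath))).
Qed.
HB.instance Definition _ := qpath_choice.

Definition path_src (p : qpath) : vertex Q := (val p).1.
Definition path_arrows (p : qpath) : seq (arrow Q) := (val p).2.
Definition path_tgt (p : qpath) : vertex Q :=
  walk_end (path_src p) (path_arrows p).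
Definition path_length (p : qpath) : nat := size (path_arrows p).

Definition trivial_path (v : vertex Q) : qpath := @QPath (v, [::]) isT.

Lemma arrow_walk (a : arrow Q) : is_walk (src a) [:: a].
Proof. by rewrite /= eqxx. Qed.

Definition arrow_path (a : arrow Q) : qpath :=
  @QPath (src a, [:: a]) (arrow_walk a).

(* [Some] of the concatenation, or [None] if [p] and [q] are not composable. *)
Definition path_cat (p q : qpath) : option qpath :=
  if path_tgt p == path_src q
  then insub (path_src p, path_arrows p ++ path_arrows q) else None.

Lemma is_walk_cat v s t :
  is_walk v (s ++ t) = is_walk v s && is_walk (walk_end v s) t.
Proof. by elim: s v => //= a s IHs v; rewrite IHs andbA. Qed.

Lemma walk_end_cat v s t : walk_end v (s ++ t) = walk_end (walk_end v s) t.
Proof. by rewrite /walk_end map_cat last_cat. Qed.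

Lemma path_cat_walk (p q : qpath) : path_tgt p = path_src q ->
  is_walk (path_src p) (path_arrows p ++ path_arrows q).
Proof.
rewrite is_walk_cat -/(path_tgt p) => ->.
by rewrite (valP p) (valP q).
Qed.

Definition composite (p q : qpath) (h : path_tgt p = path_src q) : qpath :=
  @QPath (path_src p, path_arrows p ++ path_arrows q) (path_cat_walk h).

Lemma path_catP (p q : qpath) (h : path_tgt p = path_src q) :
  path_cat p q = Some (composite h).
Proof.
rewrite /path_cat h eqxx.
case: insubP => [r _ e|/negP[]]; last exact: path_cat_walk.
by congr Some; apply: val_inj.
Qed.

Lemma path_cat_None (p q : qpath) : path_tgt p != path_src q ->
  path_cat p q = None.
Proof. by rewrite /path_cat => /negbTE->. Qed.

Lemma path_catA (p q r : qpath) :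
  obind (path_cat p) (path_cat q r) = obind (path_cat^~ r) (path_cat p q).
Proof.
have [pq|npq] := eqVneq (path_tgt p) (path_src q); last first.
  rewrite (path_cat_None npq); have [qr|nqr] := eqVneq (path_tgt q) (path_src r).
    by rewrite (path_catP qr) /= path_cat_None.
  by rewrite (path_cat_None nqr).
rewrite (path_catP pq) /=.
have [qr|nqr] := eqVneq (path_tgt q) (path_src r); last first.
  rewrite (path_cat_None nqr) path_cat_None //.
  by rewrite /path_tgt /= walk_end_cat -/(path_tgt p) pq.
rewrite (path_catP qr) /= path_catP //.
have pqr : path_tgt (composite pq) = path_src r.
  by rewrite /path_tgt /= walk_end_cat -/(path_tgt p) pq.
rewrite (path_catP pqr); congr Some; apply: val_inj.
by rewrite /= /path_arrows /= catA.
Qed.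

Lemma path_cat_trivl (p : qpath) : path_cat (trivial_path (path_src p)) p = Some p.
Proof.
rewrite path_catP //; congr Some; apply: val_inj => /=.
by rewrite [RHS]surjective_pairing.
Qed.

Lemma path_cat_trivr (p : qpath) : path_cat p (trivial_path (path_tgt p)) = Some p.
Proof.
rewrite path_catP //; congr Some; apply: val_inj => /=.
by rewrite /path_arrows /= cats0 [RHS]surjective_pairing.
Qed.

End Paths.

Definition path_algebra (K : fieldType) (Q : quiver) : Type := {malg K[qpath Q]}.

HB.instance Definition _ (K : fieldType) (Q : quiver) :=
  GRing.Lmodule.on (path_algebra K Q).

Definition path_elt (K : fieldType) (Q : quiver) (p : qpath Q) :
  path_algebra K Q := << p >>.
Arguments path_elt K {Q} p.

Section PathAlgebra.
Variables (K : fieldType) (Q : quiver).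
Local Notation KQ := (path_algebra K Q).

Local Notation path_elt := (@path_elt K Q).

Definition path_mul (p q : qpath Q) : KQ := oapp path_elt 0 (path_cat p q).

Definition pa_mul (x y : KQ) : KQ :=
  \sum_(p <- msupp x) \sum_(q <- msupp y) (x@_p * y@_q) *: path_mul p q.

Definition pa_one : KQ := \sum_(v : vertex Q) path_elt (trivial_path v).

Section LinearExtension.
Variables (V : lmodType K) (h : qpath Q -> V).

Definition lin_ext (x : KQ) : V := \sum_(p <- msupp x) x@_p *: h p.

Lemma lin_extw (d : {fset qpath Q}) (x : KQ) : (msupp x `<=` d)%fset ->
  lin_ext x = \sum_(p <- d) x@_p *: h p.
Proof.
move=> le; rewrite /lin_ext (big_fset_incl _ le) // => p _ /mcoeff_outdom ->.
by rewrite scale0r.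
Qed.

Lemma lin_ext_is_linear : linear lin_ext.
Proof.
move=> a x y; pose d := (msupp x `|` msupp y)%fset.
have dx : (msupp x `<=` d)%fset by apply: fsubsetUl.
have dy : (msupp y `<=` d)%fset by apply: fsubsetUr.
have dxy : (msupp (a *: x + y : KQ) `<=` d)%fset.
  apply: fsubset_trans (msuppD_le _ _) _; apply: fsetSU; exact: msuppZ_le.
rewrite (lin_extw dx) (lin_extw dy) (lin_extw dxy) scaler_sumr -big_split /=.
by apply: eq_bigr => p _; rewrite mcoeffD mcoeffZ scalerDl scalerA.
Qed.

HB.instance Definition _ :=
  GRing.isLinear.Build K KQ V *:%R lin_ext lin_ext_is_linear.

Lemma lin_ext_elt p : lin_ext (path_elt p) = h p.
Proof.
rewrite (@lin_extw [fset p]%fset) ?msuppU_le // big_seq_fset1.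
by rewrite mcoeffUU scale1r.
Qed.

End LinearExtension.

Lemma path_algebra_basis (x : KQ) :
  x = \sum_(p <- msupp x) x@_p *: path_elt p.
Proof.
rewrite {1}(monalgE x); apply: eq_bigr => p _.
by apply/malgP => q; rewrite mcoeffZ !mcoeffU mulr_natr.
Qed.

Lemma pa_mulE (x y : KQ) :
  pa_mul x y = lin_ext (fun p => lin_ext (path_mul p) y) x.
Proof.
apply: eq_bigr => p _; rewrite /lin_ext scaler_sumr.
by apply: eq_bigr => q _; rewrite scalerA.
Qed.

Lemma pa_mulEr (x y : KQ) :
  pa_mul x y = lin_ext (fun q => lin_ext (path_mul^~ q) x) y.
Proof.
rewrite /pa_mul exchange_big; apply: eq_bigr => q _.
rewrite /lin_ext scaler_sumr; apply: eq_bigr => p _.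
by rewrite scalerA mulrC.
Qed.

Lemma pa_mul_elt p q : pa_mul (path_elt p) (path_elt q) = path_mul p q.
Proof. by rewrite pa_mulE !lin_ext_elt. Qed.

Lemma pa_ind (P : KQ -> Prop) :
  P 0 -> (forall a p x, P x -> P (a *: path_elt p + x)) -> forall x, P x.
Proof.
move=> P0 PS x; rewrite [x]path_algebra_basis.
by elim: (enum_fset _) => [|p r IHr]; rewrite ?big_nil // big_cons; apply: PS.
Qed.

Lemma pa_mul_suml (I : Type) (r : seq I) (F : I -> KQ) y :
  pa_mul (\sum_(i <- r) F i) y = \sum_(i <- r) pa_mul (F i) y.
Proof. by rewrite pa_mulE raddf_sum; apply: eq_bigr => i _; rewrite pa_mulE. Qed.

Lemma pa_mul_sumr (I : Type) (r : seq I) (F : I -> KQ) x :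
  pa_mul x (\sum_(i <- r) F i) = \sum_(i <- r) pa_mul x (F i).
Proof. by rewrite pa_mulEr raddf_sum; apply: eq_bigr => i _; rewrite pa_mulEr. Qed.

Lemma pa_mulZl a (x y : KQ) : pa_mul (a *: x) y = a *: pa_mul x y.
Proof. by rewrite !pa_mulE linearZ. Qed.

Lemma pa_mulZr a (x y : KQ) : pa_mul x (a *: y) = a *: pa_mul x y.
Proof. by rewrite !pa_mulEr linearZ. Qed.

Lemma pa_mulDl : left_distributive pa_mul +%R.
Proof. by move=> x y z; rewrite !pa_mulE linearD. Qed.

Lemma pa_mulDr : right_distributive pa_mul +%R.
Proof. by move=> x y z; rewrite !pa_mulEr linearD. Qed.

Lemma pa_mul0l (x : KQ) : pa_mul 0 x = 0.
Proof. by rewrite pa_mulE linear0. Qed.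

Lemma pa_mul0r (x : KQ) : pa_mul x 0 = 0.
Proof. by rewrite pa_mulEr linear0. Qed.

Lemma pa_mul_eltA p q r :
  pa_mul (path_elt p) (pa_mul (path_elt q) (path_elt r)) =
  pa_mul (pa_mul (path_elt p) (path_elt q)) (path_elt r).
Proof.
rewrite (pa_mul_elt q r) (pa_mul_elt p q); have := path_catA p q r.
rewrite /path_mul.
by case: (path_cat q r) => [qr|]; case: (path_cat p q) => [pq|] /=;
  rewrite ?pa_mul_elt ?pa_mul0l ?pa_mul0r /path_mul //; [move->|move->|move<-].
Qed.

Lemma pa_mulA : associative pa_mul.
Proof.
have Az p q z : pa_mul (path_elt p) (pa_mul (path_elt q) z) =
                pa_mul (pa_mul (path_elt p) (path_elt q)) z.
  elim/pa_ind: z => [|a r z IHz]; first by rewrite !pa_mul0r.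
  rewrite !pa_mulDr IHz (pa_mulZr a (path_elt q)).
  by rewrite (pa_mulZr a (path_elt p)) (pa_mulZr a (pa_mul _ _)) pa_mul_eltA.
have Ay p y z : pa_mul (path_elt p) (pa_mul y z) =
                pa_mul (pa_mul (path_elt p) y) z.
  elim/pa_ind: y => [|a q y IHy]; first by rewrite !(pa_mul0l, pa_mul0r).
  rewrite pa_mulDl !pa_mulDr pa_mulDl IHy (pa_mulZl a (path_elt q)).
  rewrite !(pa_mulZr a (path_elt p)) Az.
  by rewrite (pa_mulZl a (pa_mul (path_elt p) (path_elt q))).
elim/pa_ind => [|a p x IHx] y z; first by rewrite !pa_mul0l.
rewrite !pa_mulDl IHx !(pa_mulZl a (path_elt p)) Ay.
by rewrite (pa_mulZl a (pa_mul (path_elt p) y)).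
Qed.

Lemma pa_mul1l : left_id pa_one pa_mul.
Proof.
elim/pa_ind => [|a p x IHx]; first by rewrite pa_mul0r.
rewrite pa_mulDr IHx (pa_mulZr a pa_one (path_elt p)).
suff -> : pa_mul pa_one (path_elt p) = path_elt p by [].
rewrite /pa_one pa_mul_suml (bigD1 (path_src p)) //= pa_mul_elt.
rewrite /path_mul path_cat_trivl /= big1 ?addr0 // => v nv.
by rewrite pa_mul_elt /path_mul path_cat_None.
Qed.

Lemma pa_mul1r : right_id pa_one pa_mul.
Proof.
elim/pa_ind => [|a p x IHx]; first by rewrite pa_mul0l.
rewrite pa_mulDl IHx (pa_mulZl a (path_elt p) pa_one).
suff -> : pa_mul (path_elt p) pa_one = path_elt p by [].
rewrite /pa_one pa_mul_sumr (bigD1 (path_tgt p)) //= pa_mul_elt.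
rewrite /path_mul path_cat_trivr /= big1 ?addr0 // => v nv.
by rewrite pa_mul_elt /path_mul path_cat_None // eq_sym.
Qed.

(* Only [pzRingType]: the path algebra of the empty quiver is the zero ring. *)
HB.instance Definition _ := GRing.Zmodule_isPzRing.Build KQ
  pa_mulA pa_mul1l pa_mul1r pa_mulDl pa_mulDr.

End PathAlgebra.

Section PathAlgebraTheory.
Variables (K : fieldType) (Q : quiver).
Local Notation KQ := (path_algebra K Q).

Lemma pa_scalerAl a (x y : KQ) : a *: (x * y) = (a *: x) * y.
Proof. by rewrite -[LHS]pa_mulZl. Qed.

Lemma pa_scalerAr a (x y : KQ) : a *: (x * y) = x * (a *: y).
Proof. by rewrite -[LHS]pa_mulZr. Qed.

Definition idem_elt (v : vertex Q) : KQ := path_elt K (trivial_path v).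
Definition arrow_elt (a : arrow Q) : KQ := path_elt K (arrow_path a).

Definition two_sided_ideal (I : set KQ) : Prop :=
  [/\ I 0, forall x y, I x -> I y -> I (x + y)
    & forall a x b, I x -> I (a * x * b)].

Definition ideal_gen (S : set KQ) : set KQ := smallest two_sided_ideal S.

Definition arrow_ideal : set KQ := ideal_gen (range arrow_elt).

Definition admissible_ideal (I : set KQ) : Prop :=
  two_sided_ideal I /\
  I `<=` ideal_gen [set x * y | x in arrow_ideal & y in arrow_ideal].

(* The classes of the [b i] form a basis of the image of [V] in [KQ/I]. *)
Definition quotient_basis (I V : set KQ) (d : nat) (b : 'I_d -> KQ) : Prop :=
  [/\ forall i, V (b i),
      forall c : 'I_d -> K, I (\sum_i c i *: b i) -> forall i, c i = 0
    & forall x, V x -> exists c : 'I_d -> K, I (x - \sum_i c i *: b i)].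

Definition finite_dim_quotient (I : set KQ) : Prop :=
  exists d (b : 'I_d -> KQ), quotient_basis I setT b.

(* The dimension of the image of [V] in [KQ/I] ([0] if it is infinite). *)
Definition quotient_dim (I V : set KQ) : nat :=
  xget 0%N [set d | exists b : 'I_d -> KQ, quotient_basis I V b].

Record gentle (I : set KQ) : Prop := Gentle {
  gentle_admissible : admissible_ideal I;
  gentle_out : forall v, (#|[pred a : arrow Q | src a == v]| <= 2)%N;
  gentle_in : forall v, (#|[pred a : arrow Q | tgt a == v]| <= 2)%N;
  gentle_nonzero_right : forall a b b' : arrow Q,
    ~ I (arrow_elt a * arrow_elt b) -> ~ I (arrow_elt a * arrow_elt b') ->
    b = b';
  gentle_nonzero_left : forall a c c' : arrow Q,
    ~ I (arrow_elt c * arrow_elt a) -> ~ I (arrow_elt c' * arrow_elt a) ->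
    c = c';
  gentle_gen : exists R : set (qpath Q),
    (forall p, R p -> path_length p = 2) /\ I = ideal_gen (@path_elt K Q @` R);
  gentle_zero_right : forall a b b' : arrow Q,
    tgt a = src b -> I (arrow_elt a * arrow_elt b) ->
    tgt a = src b' -> I (arrow_elt a * arrow_elt b') -> b = b';
  gentle_zero_left : forall a c c' : arrow Q,
    tgt c = src a -> I (arrow_elt c * arrow_elt a) ->
    tgt c' = src a -> I (arrow_elt c' * arrow_elt a) -> c = c'
}.

Definition homogeneous_part (n : nat) : set KQ :=
  [set x | forall p, p \in msupp x -> path_length p = n].

(* [(e_i A e_j)_n] for [A = KQ/I] is the image of this subspace in [A]. *)
Definition corner_part (i j : vertex Q) (n : nat) : set KQ :=
  [set idem_elt i * x * idem_elt j | x in homogeneous_part n].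

(* The polynomial whose coefficients are the [dim (e_i A e_j)_n]; it exists
   whenever [A] is finite-dimensional. *)
Definition cartan_poly (I : set KQ) (i j : vertex Q) : {poly int} :=
  xget 0 [set c : {poly int} |
           forall n, c`_n = (quotient_dim I (corner_part i j n))%:Z].

Definition q_cartan_matrix (I : set KQ) : 'M[{poly int}]_#|vertex Q| :=
  \matrix_(i, j) cartan_poly I (enum_val i) (enum_val j).

Definition zero_relation (I : set KQ) : rel (arrow Q) :=
  fun a b => (tgt a == src b) && `[< I (arrow_elt a * arrow_elt b) >].

(* [cycle] includes the relation between the last and the first arrow. *)
Definition minimal_zero_cycle (I : set KQ) (k : nat)
    (p : k.-tuple (arrow Q)) : bool :=
  cycle (zero_relation I) p && uniq p.

Definition rotation_class (k : nat) (p : k.-tuple (arrow Q)) :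
    {set k.-tuple (arrow Q)} :=
  [set rot_tuple i p | i : 'I_k]%SET.

Definition num_minimal_zero_cycles (I : set KQ) (k : nat) : nat :=
  #|[set rotation_class p | p : k.-tuple (arrow Q)
                          & minimal_zero_cycle I p]%SET|.

End PathAlgebraTheory.

Section Special.
Variables (K : fieldType) (Q : quiver) (Sp : {set vertex Q}).

Definition sp_quiver : quiver :=
  @Quiver (vertex Q) (arrow Q + {v | v \in Sp})%type
    (fun a => match a with inl b => src b | inr v => val v end)
    (fun a => match a with inl b => tgt b | inr v => val v end).

Definition sp_ideal (I : set (path_algebra K Q)) :
    set (path_algebra K sp_quiver) :=
  ideal_gen (
    [set x | exists a b : arrow Q,
       [/\ tgt a = src b, I (arrow_elt K a * arrow_elt K b)
         & x = arrow_elt K (inl a : arrow sp_quiver)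
               * arrow_elt K (inl b : arrow sp_quiver)]] `|`
    [set arrow_elt K (inr v : arrow sp_quiver) ^+ 2 | v in setT]).

Definition admissible_special (I : set (path_algebra K Q)) : Prop :=
  gentle (sp_ideal I) /\ finite_dim_quotient (sp_ideal I).

(* [inl v] is a non-special vertex; [inr (v, true)] and [inr (v, false)] are
   the two copies [v^+] and [v^-] of a special vertex. *)
Definition hat_vertex : finType :=
  ({v | v \notin Sp} + {v | v \in Sp} * bool)%type.

Definition below_vertex (x : hat_vertex) : vertex Q :=
  match x with inl v => val v | inr (v, _) => val v end.

(* One arrow over [a] for each choice of a vertex over [src a] and of a vertex
   over [tgt a]: one, two or four arrows. *)
Definition hat_arrow : finType :=
  {axy : arrow Q * (hat_vertex * hat_vertex) |
    (below_vertex axy.2.1 == src axy.1) && (below_vertex axy.2.2 == tgt axy.1)}.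

Definition below_arrow (A : hat_arrow) : arrow Q := (val A).1.

Definition hat_quiver : quiver :=
  @Quiver hat_vertex hat_arrow (fun A => (val A).2.1) (fun A => (val A).2.2).

Definition valency (v : vertex Q) : nat :=
  (#|[pred a : arrow Q | tgt a == v]| + #|[pred a : arrow Q | src a == v]|)%N.

Definition hat_zero_relations (I : set (path_algebra K Q)) :
    set (path_algebra K hat_quiver) :=
  [set x | exists A B : arrow hat_quiver,
     let a := below_arrow A in let b := below_arrow B in
     [/\ tgt a = src b, I (arrow_elt K a * arrow_elt K b), tgt a \notin Sp,
         tgt A = src B & x = arrow_elt K A * arrow_elt K B]].

Definition hat_mesh_relations (I : set (path_algebra K Q)) :
    set (path_algebra K hat_quiver) :=
  [set x | exists (v : {v | v \in Sp}) (a b : arrow Q)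
                  (A B A' B' : arrow hat_quiver),
     [/\ [/\ valency (val v) = 2, tgt a = val v, src b = val v
           & I (arrow_elt K a * arrow_elt K b)],
         [/\ below_arrow A = a, below_arrow B = b,
             tgt A = inr (v, true) & src B = inr (v, true)],
         [/\ below_arrow A' = a, below_arrow B' = b,
             tgt A' = inr (v, false) & src B' = inr (v, false)],
         src A = src A' /\ tgt B = tgt B'
       & x = arrow_elt K A * arrow_elt K B - arrow_elt K A' * arrow_elt K B']].

Definition hat_ideal (I : set (path_algebra K Q)) :
    set (path_algebra K hat_quiver) :=
  ideal_gen (hat_zero_relations I `|` hat_mesh_relations I).

End Special.

Arguments sp_ideal {K Q} Sp I.
Arguments hat_zero_relations {K Q} Sp I.
Arguments hat_mesh_relations {K Q} Sp I.
Arguments hat_ideal {K Q} Sp I.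

Definition unimodularly_equivalent (n : nat) (C D : 'M[{poly int}]_n) : Prop :=
  exists P P' : 'M[{poly int}]_n,
    [/\ \det P = 1, \det P' = 1 & D = P *m C *m P'].

(* Main.v *)
Require Import Defs.
From mathcomp Require Import boolp classical_sets monalg finmap.
From mathcomp Require Import all_boot perm all_order all_algebra.

(** Write [q] for ['X], [Z a b] for a zero relation [ab] of the gentle quiver,
    and [T a b] for a composable pair [ab] that is not a zero relation or that
    passes a special vertex. By gentleness of the quiver with special loops, a
    pair that passes a special vertex is always a zero relation ([Z] and [T]
    both hold); hence the number of vertices of the hat quiver over [tgt a],
    which is 1 or 2, satisfies
<<
      #{y over tgt a} * [tgt a = src b]  =  T a b + Z a b.             (1)
>>
    A basis of the hat algebra is given by the [T]-walks together with a choice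
    of hat vertices over their two end points ([walk_congruent] moves a path
    through the copies of a special vertex, [over_form] separates different
    walks). The walks are bounded, since inserting the special loops turns them
    into nonzero paths of a finite-dimensional algebra
    ([nonzero_pair_bounded]). So the q-Cartan matrix is [C = 1 + S R], where
    [S x a] says that [a] starts below [x], and row [a] of [R] counts the walks
    that begin with [a]. With [G a y] saying that [a] ends below [y], one has
    [R = q (G + T R)], and (1) is the matrix equation [G S = T + Z], whence
<<
      R + q Z R = q G C.                                                (2)
>>
    Now [Z] is a partial permutation, so summing (2) with alternating powers of
    [q] along a zero cycle [c] of length [k] writes [(1 - (-q)^k) R_c] as [q]
    times a combination of rows of [C]. To turn this into a diagonal form of
    [C], each zero cycle needs a vertex of its own, whose row is to be replaced.
    As [T] is acyclic, a nonempty union of zero cycles has an arrow [c] without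
    [T]-successor in the union. Its end point is not special, and no other
    arrow of the union ends there. Removing the cycle of [c] and repeating
    yields one cut arrow per cycle, the cycles being numbered by a level such
    that every other arrow with the end point of a cut has smaller level
    ([exists_cuts]).

    Let [U] perform these row operations at the end points of the cuts. It is
    unitriangular for the levels, and [U C = Delta Y], where [Delta] is diagonal
    with entries [1 - (-q)^k] at the end points of the cuts and [1] elsewhere,
    and [Y = 1 + S' R], with [S'] obtained from [S] by forgetting the arrow
    that follows each cut ([reduction_rows]). In the analogue of (2) for [Y],
    the matrix [1 + q Z] is replaced by [1 + q (G S' - T)], in which the cycles
    are cut open; it is unitriangular for the level and the position in the
    opened chain, so [Y] is invertible ([det_reduced]), and
    [U C Y^-1 = Delta]. *)

Set Implicit Arguments.
Unset Strict Implicit.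
Unset Printing Implicit Defensive.

Import GRing.Theory.
Local Open Scope ring_scope.

(** * Matrices indexed by finite types *)

Section FunctionMatrices.
Variable R : comNzRingType.

Definition mxf (I J : finType) (f : I -> J -> R) : 'M[R]_(#|I|, #|J|) :=
  \matrix_(i, j) f (enum_val i) (enum_val j).

Lemma mxf_mul (I J L : finType) (f : I -> J -> R) (g : J -> L -> R) :
  mxf f *m mxf g = mxf (fun x z => \sum_y f x y * g y z).
Proof.
apply/matrixP=> i k; rewrite !mxE [RHS](reindex_onto enum_val enum_rank) /=.
  by apply: eq_big => j; rewrite ?mxE ?enum_valK ?eqxx.
by move=> y _; rewrite enum_rankK.
Qed.

Lemma mxf1 (I : finType) : 1%:M = mxf (fun x y : I => (x == y)%:R).
Proof. by apply/matrixP=> i j; rewrite !mxE (inj_eq enum_val_inj). Qed.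

(** In the Leibniz expansion, a nonidentity permutation contributing a nonzero
    term would increase the sum of the ranks, which it only permutes. *)
Lemma det_ranked n (rk : 'I_n -> nat) (A : 'M[R]_n) :
  (forall i, A i i = 1) ->
  (forall i j, i != j -> A i j != 0 -> (rk i < rk j)%N) ->
  \det A = 1.
Proof.
move=> A1 Ark; rewrite /determinant (bigD1 (1%g : {perm 'I_n})) //=.
rewrite odd_perm1 mul1r [X in X + _]big1; last first.
  by move=> i _; rewrite perm1.
rewrite [X in _ + X]big1 ?addr0 // => s s1.
suff [i /eqP Ai0] : exists i, A i (s i) == 0.
  by rewrite (bigD1 i) //= Ai0 mul0r mulr0.
apply/existsP; apply: contraNT s1; rewrite negb_exists => /forallP An0.
have le_rk i : (rk i <= rk (s i))%N.
  have [e|ne] := eqVneq i (s i); first by rewrite -e.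
  by apply/ltnW/Ark.
have eq_sum : (\sum_i rk (s i) = \sum_i rk i)%N.
  by rewrite [RHS](reindex_inj (@perm_inj _ s)).
apply/eqP/permP=> i; rewrite perm1; apply/eqP; apply/negP => /negP nsi.
have := Ark i (s i); rewrite eq_sym nsi An0 => /(_ isT isT) lt_rk.
suff : (\sum_i rk i < \sum_i rk (s i))%N by rewrite eq_sum ltnn.
rewrite (bigD1 i) //= [ltnRHS](bigD1 i) //= -addSn leq_add //.
by apply: leq_sum.
Qed.

Lemma det_mxf_ranked (I : finType) (rk : I -> nat) (f : I -> I -> R) :
  (forall x, f x x = 1) ->
  (forall x y, x != y -> f x y != 0 -> (rk x < rk y)%N) ->
  \det (mxf f) = 1.
Proof.
move=> f1 frk; apply: (@det_ranked _ (fun i => rk (enum_val i))) => [i|i j ij].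
  by rewrite mxE.
by rewrite mxE; apply: frk; rewrite (inj_eq enum_val_inj).
Qed.

End FunctionMatrices.

(** * Cycles of a partial injection *)

Section ZeroCycles.
Variables (E : finType) (Z : rel E).
Hypothesis Z_right : forall a b b', Z a b -> Z a b' -> b = b'.
Hypothesis Z_left : forall a a' b, Z a b -> Z a' b -> a = a'.

Definition cyclic : pred E := fun a => [exists b, Z a b && connect Z b a].

(** The successor along the cycle, extended by the identity so as to be a
    permutation of [E]. *)
Definition znext (a : E) : E :=
  if cyclic a then odflt a [pick b | Z a b] else a.

Lemma znextP a : cyclic a -> Z a (znext a).
Proof.
move=> ca; rewrite /znext ca; case: pickP => [//|Z0].
by case/existsP: ca => b; rewrite Z0.
Qed.

Lemma znext_eq a b : cyclic a -> Z a b -> znext a = b.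
Proof. by move=> /znextP Za /(Z_right Za). Qed.

Lemma cyclic_connect a b : Z a b -> connect Z b a -> cyclic b.
Proof.
move=> Zab /connectP[[|c p] /= Zp e].
  by apply/existsP; exists b; rewrite -{1}e Zab connect0.
case/andP: Zp => Zbc Zp; apply/existsP; exists c; rewrite Zbc.
by apply: connect_trans (connect1 Zab); apply/connectP; exists p.
Qed.

Lemma cyclic_znext a : cyclic (znext a) = cyclic a.
Proof.
case: (boolP (cyclic a)) => [ca|/negbTE nca]; last by rewrite /znext nca.
have /existsP[b /andP[Zab ba]] := ca.
by rewrite (znext_eq ca Zab); apply: cyclic_connect ba.
Qed.

Lemma znext_inj : injective znext.
Proof.
move=> a b e; have := cyclic_znext a; rewrite e cyclic_znext => cab.
case: (boolP (cyclic a)) => ca; last first.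
  by move: e; rewrite /znext (negbTE ca) cab (negbTE ca).
by apply: Z_left (znextP ca) _; rewrite e; apply: znextP; rewrite cab.
Qed.

Lemma cyclic_iter n a : cyclic (iter n znext a) = cyclic a.
Proof. by elim: n => //= n IHn; rewrite cyclic_znext. Qed.

Definition cycle_transversal (A D : {set E}) : Prop :=
  [/\ {subset D <= A},
      forall a, a \in A -> exists2 c, c \in D & fconnect znext a c &
      forall c c', c \in D -> c' \in D -> fconnect znext c c' -> c = c'].

Section Cuts.
Variable T : rel E.
Variable V : finType.
Variables s t : E -> V.
Hypothesis T_wf : forall A : {set E}, A != set0 ->
  exists2 a, a \in A & forall b, b \in A -> ~~ T a b.
Hypothesis Z_comp : forall a b, Z a b -> s b = t a.
Hypothesis TZ_comp : forall a b, t a = s b -> T a b || Z a b.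

(** The cycles in [A], cut open after the elements of [D], hang on each other
    as a forest: any other element with the end point of a cut lies on a cycle
    of smaller level, or on none at all (level [0]). *)
Definition cut_system (A D : {set E}) (lev : E -> nat) : Prop :=
  [/\ cycle_transversal A D,
      forall a, lev (znext a) = lev a,
      forall a, (a \in A) = (0 < lev a)%N,
      forall c, c \in D -> ~~ T c (znext c) &
      forall c d, c \in D -> d != c -> t d = t c -> (lev d < lev c)%N].

(** The first cut is an element [a] of [A] without [T]-successor in [A]. If
    another element of [A] ended where [a] does, its successor would be a
    [T]-successor of [a], since it is not the [Z]-successor of [a]. Hence the
    cycle of [a] can be a root, and the other cycles are cut by induction, one
    level up. *)
Lemma exists_cuts (A : {set E}) : (forall a, a \in A -> cyclic a) ->
  (forall a, (znext a \in A) = (a \in A)) ->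
  exists (D : {set E}) (lev : E -> nat), cut_system A D lev.
Proof.
have symz := fconnect_sym znext_inj.
pose stable (B : {set E}) := forall a, (znext a \in B) = (a \in B).
move: {2}#|A| (leqnn #|A|) => n; rewrite -/(stable A).
elim: n A => [|n IHn] A leA cA sA.
  move: leA; rewrite leqn0 cards_eq0 => /eqP ->.
  exists set0, (fun=> 0%N).
  split=> //; first split=> //; by move=> a; rewrite inE.
have [->|A0] := eqVneq A set0.
  exists set0, (fun=> 0%N).
  split=> //; first split=> //; by move=> a; rewrite inE.
have [a aA aT] := T_wf A0.
pose O := [set b | fconnect znext a b]%SET.
have sO : stable O.
  by move=> b; rewrite !inE symz [RHS]symz -(same_fconnect1 znext_inj).
have [|||D [lev [[DA Dex Dun] lev1 lev0 DT Dlt]]] := IHn (A :\: O).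
- rewrite -ltnS (leq_trans _ leA) // proper_card // properE subsetDl.
  by apply/subsetPn; exists a; rewrite // !inE connect0.
- by move=> b; rewrite inE => /andP[_ /cA].
- by move=> b; rewrite !in_setD sA sO.
exists (a |: D), (fun b => lev b + (b \in A))%N; split.
- split=> [c|b bA|c c'].
  + by rewrite inE => /orP[/set1P->|/DA]; rewrite // inE => /andP[].
  + have [bO|bO] := boolP (b \in O).
      by exists a; rewrite ?setU11 //; rewrite symz; rewrite inE in bO.
    have [|c cD bc] := Dex b; first by rewrite inE bO.
    by exists c; rewrite // setU1r.
  + have DO c1 : c1 \in D -> c1 \notin O by move/DA; rewrite inE => /andP[].
    rewrite !in_setU1 => /orP[/eqP->|cD] /orP[/eqP->|c'D] //.
    * by move=> ac; case/negP: (DO _ c'D); rewrite inE.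
    * by move=> ac; case/negP: (DO _ cD); rewrite inE symz.
    * exact: Dun.
- by move=> b; rewrite lev1 sA.
- move=> b; rewrite addn_gt0 -lev0 lt0b inE.
  by case: (b \in A); rewrite ?andbT ?andbF ?orbT.
- by move=> c; rewrite in_setU1 => /orP[/eqP->|/DT//]; rewrite aT // sA.
move=> c d; rewrite in_setU1 => /orP[/eqP->|cD] dc td; last first.
  have := DA c cD; rewrite inE => /andP[_ ->].
  have := Dlt c d cD dc td; case: (d \in A) => lt; rewrite ?addn1 ?ltnS //.
  by rewrite addn0 ltnW.
have dA : d \notin A.
  apply/negP => dA; have cd := cA _ dA; have Zd := znextP cd.
  have : T a (znext d) || Z a (znext d) by apply: TZ_comp; rewrite (Z_comp Zd).
  rewrite (negbTE (aT _ _)) ?sA //= => /Z_left/(_ Zd) ad.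
  by rewrite ad eqxx in dc.
rewrite (negbTE dA) aA addn0 addn1 ltnS.
have : ~~ (0 < lev d)%N by rewrite -lev0 inE (negbTE dA) andbF.
by rewrite -leqNgt leqn0 => /eqP->.
Qed.

End Cuts.

(** Once every cycle has been cut at an element of [D], the relation [Z] is
    acyclic, so the number of elements reachable from [a] decreases. *)
Lemma cut_rank (D : {set E}) :
  (forall a, cyclic a -> exists2 c, c \in D & fconnect znext a c) ->
  exists pos : E -> nat,
    forall a b, Z a b -> a \notin D -> (pos b < pos a)%N.
Proof.
move=> Dex; pose r : rel E := fun a b => Z a b && (a \notin D).
exists (fun a => #|connect r a|) => a b Zab aD.
have rab : r a b by rewrite /r Zab.
apply: proper_card; apply/properP; split.
  apply/subsetP=> x; rewrite -!topredE /=.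
  by move=> bx; apply: connect_trans (connect1 rab) bx.
exists a; first exact: connect0.
apply/negP; rewrite -topredE /= => ba.
have ca : cyclic a.
  apply/existsP; exists b; rewrite Zab /=.
  by apply: connect_sub ba => x y /andP[Zxy _]; apply: connect1.
have zr i : connect r (iter i znext a) a /\ iter i znext a \notin D.
  elim: i => [|i [IHc IHD]] /=; first by split.
  have ci : cyclic (iter i znext a) by rewrite cyclic_iter.
  have cz : connect r (znext (iter i znext a)) a.
    case/connectP: IHc => [[|y p] /= rp e].
      by rewrite -e (znext_eq ca Zab).
    case/andP: rp => /andP[Zy _] rp; rewrite (znext_eq ci Zy).
    by apply/connectP; exists p.
  split=> //; case/connectP: cz => [[|y p] /= rp e]; first by rewrite -e.
  by case/andP: rp => /andP[].
have [c cD /iter_findex ac] := Dex a ca.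
by have [_] := zr (findex znext a c); rewrite ac cD.
Qed.

End ZeroCycles.

(** * Diagonalizing the matrix of walks *)

Lemma flatten_cons_uniq (A : eqType) (r : seq A) (P : pred A)
    (f : A -> seq (seq A)) : uniq r -> (forall b, uniq (f b)) ->
  uniq (flatten [seq [seq b :: p | p <- f b] | b <- r & P b]).
Proof.
move=> + uf; elim: r => //= b r IHr /andP[br ur].
case: ifP => _; last exact: IHr.
rewrite /= cat_uniq IHr // andbT map_inj_uniq ?uf; last by move=> p q [].
apply/hasPn => p /flatten_mapP[c]; rewrite mem_filter => /andP[_ cr].
case/mapP=> q _ ->; apply/mapP => -[q' _ [cb _]].
by rewrite cb (negbTE br) in cr.
Qed.

Section CartanMatrix.
Variables (E V W : finType) (s t : E -> V) (below : W -> V) (T Z : rel E).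
Hypothesis fibre : forall a b,
  (T a b + Z a b)%N = ((s b == t a) * #|[pred y | below y == t a]|)%N.
Hypothesis Z_right : forall a b b', Z a b -> Z a b' -> b = b'.
Hypothesis Z_left : forall a a' b, Z a b -> Z a' b -> a = a'.
Hypothesis below_surj : forall v, exists y, below y == v.
Variable N : nat.
Hypothesis T_bound : forall a p, path T a p -> (size p < N)%N.

(** The continuations of the arrow [a] to a walk; [a] itself is left out. *)
Fixpoint walks (n : nat) (a : E) (v : V) : seq (seq E) :=
  if n is n'.+1
  then flatten [seq [seq b :: p | p <- walks n' b v] | b <- enum E & T a b]
  else if t a == v then [:: [::]] else [::].

Lemma mem_walks n a v p :
  p \in walks n a v = [&& size p == n, path T a p & t (last a p) == v].
Proof.
elim: n a p => [|n IHn] a p /=.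
  by case: p => [|b p] //=; case: ifP; rewrite ?inE.
apply/flatten_mapP/idP => [[b]|].
  rewrite mem_filter => /andP[Tab _] /mapP[q]; rewrite IHn => q_ok ->.
  by rewrite /= Tab eqSS.
case: p => [//|b p] /= /and3P[]; rewrite eqSS => sp /andP[Tab Tp] tp.
exists b; first by rewrite mem_filter Tab mem_enum.
by apply/mapP; exists p; rewrite // IHn sp Tp.
Qed.

Lemma walks_uniq n a v : uniq (walks n a v).
Proof.
elim: n a => [|n IHn] a /=; first by case: ifP.
by apply: flatten_cons_uniq; rewrite ?enum_uniq.
Qed.

Lemma size_walksS n a v :
  size (walks n.+1 a v) = (\sum_(b | T a b) size (walks n b v))%N.
Proof.
rewrite /= size_flatten sumnE !big_map big_filter.
rewrite [RHS]big_mkcond /= [LHS]big_mkcond /= big_enum.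
by apply: eq_bigr => b _; rewrite size_map.
Qed.

Lemma walks_bounded n a v : (N <= n)%N -> walks n a v = [::].
Proof.
move=> leN; case e : (walks n a v) => [//|p r].
have : p \in walks n a v by rewrite e mem_head.
by rewrite mem_walks => /and3P[/eqP sp /T_bound]; rewrite sp ltnNge leN.
Qed.

(** The walks that begin with [a], counted with [a]: hence the exponent. *)
Definition walk_poly a v : {poly int} :=
  \sum_(n < N) (size (walks n a v))%:R *: 'X^(n.+1).

Lemma coef_walk_poly a v n :
  (walk_poly a v)`_n = if n is n'.+1 then (size (walks n' a v))%:R else 0.
Proof.
rewrite /walk_poly coef_sum; case: n => [|n].
  by apply: big1 => i _; rewrite coefZ coefXn mulr0.
under eq_bigr do rewrite coefZ coefXn eqSS.
have [ltn|leN] := ltnP n N; last first.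
  rewrite walks_bounded // big1 // => i _.
  by rewrite eqn_leq leqNgt (leq_trans (ltn_ord i) leN) mulr0.
rewrite (bigD1 (Ordinal ltn)) //= eqxx mulr1 big1 ?addr0 // => i.
by rewrite -val_eqE /= eq_sym => /negbTE->; rewrite mulr0.
Qed.

Lemma walk_polyE a v :
  walk_poly a v = 'X * ((t a == v)%:R + \sum_(b | T a b) walk_poly b v).
Proof.
apply/polyP=> n; rewrite coefXM coef_walk_poly; case: n => [//|n] /=.
rewrite coefD coef_sum; under eq_bigr do rewrite coef_walk_poly.
rewrite coefMn coef1; case: n => [|n] /=.
  by rewrite big1 // addr0; case: (t a == v).
by rewrite mul0rn add0r size_walksS natr_sum.
Qed.

(** Only the end vertices of a walk below have to be lifted to [W], so for
    positive length the entry depends on [below x] and [below y] alone. *)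
Definition cartan_entry x y : {poly int} :=
  (x == y)%:R + \sum_(a | s a == below x) walk_poly a (below y).

Local Notation cyc := (cyclic Z).
Local Notation z := (znext Z).
Local Notation zinj := (znext_inj Z_right Z_left).

Lemma Z_comp a b : Z a b -> s b = t a.
Proof.
move=> Zab; have := fibre a b; rewrite Zab addn1 => f.
by apply/eqP; apply/negPn/negP => /negbTE e; rewrite e in f.
Qed.

Lemma T_comp a b : T a b -> s b = t a.
Proof.
move=> Zab; have := fibre a b; rewrite Zab add1n => f.
by apply/eqP; apply/negPn/negP => /negbTE e; rewrite e in f.
Qed.

Lemma TZ_comp a b : t a = s b -> T a b || Z a b.
Proof.
move=> e; have := fibre a b; rewrite e eqxx mul1n.
case: (T a b) (Z a b) => [] [] //= /esym/card0_eq.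
by have [y yb] := below_surj (s b) => /(_ y); rewrite !inE yb.
Qed.

Lemma T_wf (A : {set E}) : A != set0 ->
  exists2 a, a \in A & forall b, b \in A -> ~~ T a b.
Proof.
case/set0Pn=> a0 a0A; apply: contrapT => noA.
have step a : a \in A -> exists2 b, b \in A & T a b.
  move=> aA; apply: contrapT => noT; apply: noA; exists a => // b bA.
  by apply/negP=> Tab; apply: noT; exists b.
suff [p Tp sp] : exists2 p, path T a0 p & size p = N.
  by have := T_bound Tp; rewrite sp ltnn.
elim: N a0 a0A => [|n IHn] a aA; first by exists [::].
have [b bA Tab] := step _ aA; have [p Tp sp] := IHn _ bA.
by exists (b :: p); rewrite /= ?Tab ?sp.
Qed.

(** The matrix equation [G S = T + Z], applied to a column of summands; the
    condition [P] restricts [S] to some of the arrows. *)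
Lemma fibre_sum (M : zmodType) (P : pred E) (F : E -> M) a :
  \sum_(x | below x == t a) \sum_(b | (s b == below x) && P b) F b =
  \sum_(b | P b) F b *+ (T a b + Z a b).
Proof.
rewrite (exchange_big_dep P) /=; last by move=> x b _ /andP[].
apply: eq_bigr => b Pb; rewrite sumr_const fibre; congr (_ *+ _).
rewrite (_ : (_ * _)%N = \sum_(x | below x == t a) (s b == t a))%N; last first.
  by rewrite sum_nat_const mulnC.
rewrite -sum1_card big_mkcond [RHS]big_mkcond; apply: eq_bigr => x _.
by rewrite unfold_in Pb andbT; case: eqP => // ->; case: eqP.
Qed.

Lemma fibre_delta a y : \sum_(x | below x == t a) (x == y)%:R =
  (t a == below y)%:R :> {poly int}.
Proof.
rewrite big_mkcond (bigD1 y) //= eqxx [t a == _]eq_sym.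
by rewrite big1 ?addr0 => [|x /negbTE->]; case: ifP.
Qed.

(** The relation [R + q Z R = q G C], which is where [Z] enters. *)
Lemma cartan_entry_fibre a y :
  'X * (\sum_(x | below x == t a) cartan_entry x y) =
  walk_poly a (below y) + 'X * (\sum_(b | Z a b) walk_poly b (below y)).
Proof.
rewrite {1}walk_polyE -mulrDr; congr (_ * _).
rewrite big_split /= -addrA; congr (_ + _).
  exact: fibre_delta.
under eq_bigr do under eq_bigl do rewrite -[_ == _]andbT.
rewrite (fibre_sum xpredT) [X in _ = X + _]big_mkcond [X in _ = _ + X]big_mkcond.
rewrite -big_split /=; apply: eq_bigr => b _; rewrite mulrnDr.
by case: (T a b); case: (Z a b).
Qed.

Section Reduction.
Variables (D : {set E}) (lev : E -> nat).
Hypothesis D_cuts : cut_system Z T t [set a | cyc a]%SET D lev.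

Let nX : {poly int} := - 'X.
Let R a y := walk_poly a (below y).

Lemma cut_cyclic c : c \in D -> cyc c.
Proof. by case: D_cuts => -[sub _ _] _ _ _ _ /sub; rewrite inE. Qed.

Lemma lev_iter n a : lev (iter n z a) = lev a.
Proof.
by case: D_cuts => _ lev_z _ _ _; elim: n => //= n; rewrite lev_z.
Qed.

Lemma cut_zero c : c \in D -> Z c (z c).
Proof. by move/cut_cyclic; apply: znextP. Qed.

Lemma cut_lev c d : c \in D -> d != c -> t d = t c -> (lev d < lev c)%N.
Proof. by case: D_cuts => _ _ _ _; apply. Qed.

Lemma cut_nonzero c : c \in D -> ~~ T c (z c).
Proof. by case: D_cuts => _ _ _ + _; apply. Qed.

Lemma cut_lev_nonzero a c : c \in D -> T a (z c) -> (lev a < lev c)%N.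
Proof.
move=> cD Tac; apply: cut_lev => //.
  by apply: contraTneq Tac => ->; apply: cut_nonzero.
by rewrite -(T_comp Tac) (Z_comp (cut_zero cD)).
Qed.

(** The end point of a cut is not special, so its fibre is a single vertex. *)
Lemma cut_fibre c : c \in D -> exists w, forall y, (below y == t c) = (y == w).
Proof.
move=> cD; have := fibre c (z c).
rewrite (negbTE (cut_nonzero cD)) cut_zero // (Z_comp (cut_zero cD)) eqxx mul1n.
by move=> /esym/mem_card1[w wP]; exists w => y; have := wP y; rewrite !inE.
Qed.

Lemma cut_tgt_inj c c' : c \in D -> c' \in D -> t c = t c' -> c = c'.
Proof.
move=> cD c'D e; apply/eqP/negPn/negP => ne.
have := cut_lev c'D ne e; rewrite ltnNge => /negP[].
by apply/ltnW/cut_lev; rewrite // eq_sym.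
Qed.

Definition cut_at (x : W) : option E := [pick c in D | t c == below x].

Lemma cut_atP x c : cut_at x = Some c -> c \in D /\ t c = below x.
Proof. by rewrite /cut_at; case: pickP => // c' /andP[c'D /eqP e] [<-]. Qed.

Lemma cut_atE c x : c \in D -> t c = below x -> cut_at x = Some c.
Proof.
move=> cD e; rewrite /cut_at; case: pickP => [c' /andP[c'D /eqP e']|/(_ c)].
  by congr Some; apply: cut_tgt_inj; rewrite // e'.
by rewrite cD e eqxx.
Qed.

Lemma cut_at_inj x y c : cut_at x = Some c -> below y = t c -> x = y.
Proof.
move=> /cut_atP[cD e] e'; have [w wP] := cut_fibre cD.
have /eqP -> : x == w by rewrite -wP e.
by apply/eqP; rewrite eq_sym -wP e'.
Qed.

Let cut_next := [set z c | c in D]%SET.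

Lemma cut_nextP c : c \in D -> z c \in cut_next.
Proof. by move=> cD; apply: imset_f. Qed.

Definition diagonal_entry x : {poly int} :=
  if cut_at x is Some c then 1 - nX ^+ order z c else 1.

(** The matrix [Y]: the arrows after the cuts no longer count as starting at
    their source. *)
Definition reduced_entry x y : {poly int} :=
  (x == y)%:R + \sum_(b | (s b == below x) && (b \notin cut_next)) R b y.

(** The row operations [U]: at the end point of a cut [c], the alternating sum
    over the cycle of [c] of the rows at the end points of its arrows; the
    summand [i = 0] is the row itself. *)
Definition reduction_entry x y : {poly int} :=
  if cut_at x is Some c then
    \sum_(i < order z c) nX ^+ i * (below y == t (iter i z c))%:R
  else (x == y)%:R.

(** At the end point of a cut [c], what is left of the row of [C] is what
    prolongs [c]: the other arrow starting there, if any, is the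
    [T]-successor of [c]. *)
Lemma walk_poly_cut x c y :
  cut_at x = Some c -> R c y = 'X * reduced_entry x y.
Proof.
move=> rx; have [cD e] := cut_atP rx; rewrite /R walk_polyE.
congr (_ * (_ + _)).
  congr (_ %:R); rewrite e; congr nat_of_bool.
  by apply/eqP/eqP => [exy|->//]; apply: cut_at_inj rx _; rewrite e.
apply: eq_bigl => b; rewrite -e; apply/idP/andP => [Tcb|[/eqP sb bz]].
  split; first by rewrite (T_comp Tcb).
  (* otherwise [c] would end where the cut before [b] does, hence be that cut *)
  apply/negP => /imsetP[c' c'D eb]; rewrite eb in Tcb.
  have lt := cut_lev_nonzero c'D Tcb.
  have tcc' : t c = t c' by rewrite -(T_comp Tcb) (Z_comp (cut_zero c'D)).
  by rewrite (cut_tgt_inj cD c'D) ?ltnn in lt.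
case/orP: (TZ_comp (esym sb)) => // Zcb.
by rewrite -(znext_eq Z_right (cut_cyclic cD) Zcb) cut_nextP in bz.
Qed.

(** The equation [U C = Delta Y]. By [cartan_entry_fibre], the row of [U C] at the
    end point of a cut is, up to a factor ['X], a telescoping sum along the
    cycle; as the cycle closes up, its two ends are multiples of the same row. *)
Lemma reduction_rows x y :
  \sum_w reduction_entry x w * cartan_entry w y =
  diagonal_entry x * reduced_entry x y.
Proof.
rewrite /reduction_entry /diagonal_entry.
case rx : (cut_at x) => [c|]; last first.
  rewrite (bigD1 x) //= eqxx !mul1r big1 ?addr0 => [|w]; last first.
    by rewrite eq_sym => /negbTE->; rewrite mul0r.
  congr (_ + _); apply: eq_bigl => b.
  case: eqP => //= sb; apply/esym/negP => /imsetP[c cD eb].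
  by rewrite (cut_atE (c := c)) // -sb eb (Z_comp (cut_zero cD)) in rx.
have [cD tc] := cut_atP rx.
have X0 : 'X != 0 :> {poly int} by rewrite polyX_eq0.
apply: (mulfI X0); rewrite [RHS]mulrCA -(walk_poly_cut _ rx).
under eq_bigr do rewrite mulr_suml.
rewrite exchange_big mulr_sumr /=.
transitivity (\sum_(i < order z c)
   (nX ^+ i * R (iter i z c) y - nX ^+ i.+1 * R (iter i.+1 z c) y)).
  apply: eq_bigr => i _; under eq_bigr do rewrite -mulrA.
  rewrite -mulr_sumr mulrCA.
  under eq_bigr do rewrite mulr_natl mulrb.
  rewrite -big_mkcond /= cartan_entry_fibre exprSr -mulrA -mulrBr.
  congr (_ * (_ + _)); rewrite /nX mulNr opprK; congr (_ * _).
  rewrite (big_pred1 (z (iter i z c))) // => b /=.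
  have ci : cyc (iter i z c) by rewrite (cyclic_iter Z_right) cut_cyclic.
  apply/idP/eqP => [/(znext_eq Z_right ci) //|->]; exact: znextP.
rewrite -(big_mkord xpredT (fun i => nX ^+ i * R (iter i z c) y -
   nX ^+ i.+1 * R (iter i.+1 z c) y)).
under eq_bigr do rewrite -opprB.
rewrite sumrN telescope_sumr // opprB expr0 mul1r /= (iter_order zinj).
by rewrite mulrBl mul1r.
Qed.

(** [U] is unitriangular for the level of the cut at a vertex: the row at a cut
    only uses rows at vertices that its cycle passes, and a cut at such a
    vertex has larger level. Vertices without a cut come last. *)
Lemma det_reduction : \det (mxf reduction_entry) = 1.
Proof.
have iter_neq c i : (0 < i < order z c)%N -> iter i z c != c.
  move=> /andP[i0 lti]; apply/eqP => e.
  have := findex_iter lti; rewrite e => /esym ei; rewrite ei in i0.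
  by have := findex_iter (order_gt0 z c); rewrite /= => e0; rewrite e0 in i0.
pose rk x := if cut_at x is Some c then lev c else (\sum_a lev a).+1.
apply: (@det_mxf_ranked _ _ rk) => [x|x y nxy]; rewrite /rk /reduction_entry.
  case rx : (cut_at x) => [c|]; last by rewrite eqxx.
  have [cD tc] := cut_atP rx.
  rewrite (bigD1 (Ordinal (order_gt0 z c))) //= expr0 mul1r tc eqxx.
  rewrite big1 ?addr0 // => i; rewrite -val_eqE /= -lt0n => i0.
  case: eqP => [e|_]; last by rewrite mulr0.
  have := cut_lev cD (iter_neq c i _).
  by rewrite i0 ltn_ord -e tc lev_iter ltnn => /(_ isT erefl).
case rx : (cut_at x) => [c|]; last by rewrite (negbTE nxy) eqxx.
have [cD tc] := cut_atP rx => Uxy.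
have [i /eqP yi] : exists i : 'I_(order z c), below y == t (iter i z c).
  apply/existsP; apply: contraNT Uxy; rewrite negb_exists => /forallP h.
  by rewrite big1 // => i _; rewrite (negbTE (h i)) mulr0.
case ry : (cut_at y) => [c'|]; last first.
  by rewrite ltnS (bigD1 c) //= leq_addr.
have [c'D tc'] := cut_atP ry.
rewrite -(lev_iter i c); apply: cut_lev => //; last by rewrite tc' yi.
apply: contraNneq nxy => e; have cc' : c = c'.
  case: D_cuts => -[_ _ uniqD] _ _ _ _.
  by apply: uniqD; rewrite // -e fconnect_iter.
by apply/eqP/(cut_at_inj rx); rewrite cc' tc'.
Qed.

(** The entries of [G S' - T], which by [fibre_sum] agree with those of [Z]
    except in the columns of the arrows that follow a cut. *)
Let opened a b : {poly int} :=
  if b \in cut_next then - (T a b)%:R else (Z a b)%:R.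

(** Along [opened], the level increases, or it stays and the position in the
    opened chain decreases: the factor [B] makes the level count first. *)
Lemma opened_ranked : exists rk : E -> nat,
  forall a b, opened a b != 0 -> (rk a < rk b)%N.
Proof.
have [[_ Dex _] lev_z lev_gt0 _ _] := D_cuts.
have [|pos posP] := cut_rank Z_right (D := D).
  by move=> a ca; apply: Dex; rewrite inE.
pose B := (\sum_a pos a).+1.
have posB a : (pos a < B)%N by rewrite /B ltnS (bigD1 a) //= leq_addr.
pose rk a := (lev a * B + (B - pos a))%N; exists rk => a b.
have rk1 d e : (lev d < lev e)%N -> (rk d < rk e)%N.
  move=> lt; apply: (@leq_ltn_trans (lev d * B + B)).
    by rewrite leq_add2l leq_subr.
  rewrite addnC -mulSn; apply: (@leq_ltn_trans (lev e * B)).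
    by rewrite leq_mul2r lt orbT.
  by rewrite -addn1 leq_add2l subn_gt0.
rewrite /opened; case: (boolP (b \in cut_next)) => [/imsetP[c cD ->]|bz].
  rewrite oppr_eq0; case Tac : (T a (z c)); last by rewrite eqxx.
  by move=> _; apply: rk1; rewrite lev_z; apply: cut_lev_nonzero.
case Zab : (Z a b); last by rewrite eqxx.
have : (lev a <= lev b)%N.
  have [ca|nca] := boolP (cyc a).
    by rewrite -(znext_eq Z_right ca Zab) lev_z.
  by move: (lev_gt0 a); rewrite inE (negbTE nca) lt0n => /esym/negbFE/eqP->.
rewrite leq_eqVlt => /orP[/eqP e _|/rk1//].
have aD : a \notin D.
  apply: contraNN bz => aD.
  by rewrite -(znext_eq Z_right (cut_cyclic aD) Zab) cut_nextP.
by rewrite /rk e ltn_add2l ltn_sub2l ?posB ?posP.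
Qed.

(** With [A = 1 - S' (1 + q (G S' - T))^-1 q G], the analogue of (2) reads
    [A Y = Y - S' R = 1]. So [det Y] is a unit of Z[q], that is, a constant, and
    [Y] becomes the identity matrix at [q = 0]. *)
Lemma det_reduced : \det (mxf reduced_entry) = 1.
Proof.
have [rk rkP] := opened_ranked.
have det_X : \det (mxf (fun a b => (a == b)%:R + 'X * opened a b)) = 1.
  apply: (@det_mxf_ranked _ _ rk) => [a|a b nab].
    rewrite eqxx; have [->|/rkP] := eqVneq (opened a a) 0.
      by rewrite mulr0 addr0.
    by rewrite ltnn.
  rewrite (negbTE nab) add0r => nz; apply: rkP.
  by apply: contraNneq nz => ->; rewrite mulr0.
set Xm := mxf _ in det_X.
pose Gm := mxf (fun a y => 'X * (t a == below y)%:R : {poly int}).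
pose Sm :=
  mxf (fun x a => ((s a == below x) && (a \notin cut_next))%:R : {poly int}).
have YE : mxf reduced_entry = 1%:M + Sm *m mxf R.
  rewrite mxf1 mxf_mul; apply/matrixP => i j; rewrite !mxE; congr (_ + _).
  rewrite big_mkcond; apply: eq_bigr => b _.
  by rewrite mulr_natl mulrb.
have XR : Xm *m mxf R = Gm *m mxf reduced_entry.
  rewrite !mxf_mul; apply/matrixP => i j; rewrite !mxE.
  set a := enum_val i; set y := enum_val j.
  transitivity ('X * (\sum_(x | below x == t a) reduced_entry x y)); last first.
    rewrite big_mkcond mulr_sumr; apply: eq_bigr => x _.
    by rewrite -mulrA mulr_natl mulrb eq_sym; case: ifP; rewrite ?mulr0.
  under eq_bigr do rewrite mulrDl -mulrA.
  rewrite big_split /= -mulr_sumr (bigD1 a) //= eqxx mul1r.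
  rewrite big1 ?addr0; last first.
    by move=> b; rewrite eq_sym => /negbTE->; rewrite mul0r.
  rewrite {1}/R walk_polyE -mulrDr; congr (_ * _).
  rewrite [RHS]big_split /= -addrA fibre_delta; congr (_ + _).
  rewrite fibre_sum !(big_mkcond (T a)) (big_mkcond (fun b => b \notin cut_next)).
  rewrite -big_split /=; apply: eq_bigr => b _; rewrite /opened -/(R b y).
  case: (b \in cut_next); case: (T a b); case: (Z a b);
    by rewrite /= ?mulN1r ?mul1r ?oppr0 ?mul0r ?addr0 ?add0r ?subrr ?mulr2n.
have Xu : Xm \in unitmx by rewrite unitmxE det_X unitr1.
pose A := 1%:M - Sm *m (invmx Xm *m Gm).
have AY : A *m mxf reduced_entry = 1%:M.
  rewrite mulmxBl mul1mx -!mulmxA -XR (mulKmx Xu) {1}YE.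
  by rewrite -addrA subrr addr0.
have detAY : \det A * \det (mxf reduced_entry) = 1.
  by rewrite -det_mulmx AY det1.
have : \det (mxf reduced_entry) \is a GRing.unit.
  by apply/unitrPr; exists (\det A); rewrite mulrC.
rewrite poly_unitE => /andP[/eqP /eq_leq /size1_polyC detC _].
suff det0 : (\det (mxf reduced_entry))`_0 = 1 by rewrite detC det0.
rewrite -horner_coef0 -[_.[0]]/(horner_eval 0 _) -det_map_mx.
rewrite (_ : map_mx _ _ = 1%:M) ?det1 // mxf1; apply/matrixP=> i j.
rewrite !mxE rmorphD rmorph_nat rmorph_sum big1 ?addr0 // => b _.
by rewrite /R walk_polyE rmorphM /= /horner_eval hornerX mul0r.
Qed.

Lemma diagonal_entryE k x : (0 < k)%N ->
  (diagonal_entry x == 1 - nX ^+ k) =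
  (if cut_at x is Some c then order z c == k else false).
Proof.
move=> k0; rewrite /diagonal_entry; case: (cut_at x) => [c|]; last first.
  apply/negbTE; case: k k0 => // k _; rewrite eq_sym addrC -subr_eq0 addrK.
  by rewrite oppr_eq0 expf_neq0 // oppr_eq0 polyX_eq0.
apply/eqP/eqP => [/addrI/oppr_inj|->//].
have sz n : size (nX ^+ n) = n.+1.
  rewrite exprNn -signr_odd mulr_sign.
  by case: (odd n); rewrite ?size_polyN size_polyXn.
by move=> /(congr1 (fun p : {poly int} => size p)); rewrite !sz => -[].
Qed.

Lemma card_diagonal_entry k : (0 < k)%N ->
  #|[set x | diagonal_entry x == 1 - nX ^+ k]%SET| =
  #|[set c in D | order z c == k]%SET|.
Proof.
move=> k0; set X := [set x | _]%SET.
have cut_at_injX : {in X &, injective cut_at}.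
  move=> x y; rewrite !inE !diagonal_entryE //.
  case rx : (cut_at x) => [c|//] _ _ ry.
  by apply: (cut_at_inj rx); have [_ ->] := cut_atP (esym ry).
rewrite -(card_in_imset cut_at_injX) -[RHS](card_imset _ (@Some_inj _)).
apply: eq_card => o; apply/imsetP/imsetP => [[x]|[c]]; rewrite inE.
  rewrite diagonal_entryE //; case rx : (cut_at x) => [c|//] ck ->.
  by exists c; rewrite // inE ck andbT; case: (cut_atP rx).
move=> /andP[cD ck] ->; have [x /eqP xc] := below_surj (t c).
have rx := cut_atE cD (esym xc).
by exists x; rewrite // inE diagonal_entryE // rx.
Qed.

End Reduction.

Theorem cartan_diagonalization :
  exists (D : {set E}) (d : W -> {poly int}),
  [/\ cycle_transversal Z [set a | cyc a]%SET D,
      unimodularly_equivalent (mxf cartan_entry)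
        (diag_mx (\row_i d (enum_val i))),
      forall k, (0 < k)%N ->
        #|[set x | d x == 1 - (- 'X) ^+ k]%SET| =
        #|[set c in D | order z c == k]%SET| &
      forall x, d x = 1 \/ exists2 k, (0 < k)%N & d x = 1 - (- 'X) ^+ k].
Proof.
have [||D [lev cutsD]] :=
    exists_cuts Z_right Z_left T_wf Z_comp TZ_comp (A := [set a | cyc a]%SET).
- by move=> a; rewrite inE.
- by move=> a; rewrite !inE (cyclic_znext Z_right).
have detY := det_reduced cutsD.
have Yu : mxf (reduced_entry D) \in unitmx by rewrite unitmxE detY unitr1.
exists D, (diagonal_entry D); split.
- by case: cutsD.
- exists (mxf (reduction_entry D)), (invmx (mxf (reduced_entry D))); split.
  + exact: det_reduction cutsD.
  + by rewrite det_inv detY invr1.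
  rewrite mxf_mul; set DY := mxf _.
  suff -> : DY = diag_mx (\row_i diagonal_entry D (enum_val i)) *m
      mxf (reduced_entry D) by rewrite mulmxK.
  by apply/matrixP=> i j; rewrite mul_diag_mx !mxE (reduction_rows cutsD).
- exact: card_diagonal_entry cutsD.
move=> x; rewrite /diagonal_entry; case: (cut_at D x) => [c|]; last by left.
by right; exists (order z c); rewrite ?order_gt0.
Qed.

End CartanMatrix.

(** * Counting minimal zero cycles *)

Section CountingCycles.
Variables (K : fieldType) (Q : quiver).

Lemma rotation_classP k (p p' : k.-tuple (arrow Q)) : (0 < k)%N ->
  reflect (exists i, p' = rot i p :> seq _) (p' \in rotation_class p).
Proof.
move=> k0; apply: (iffP imsetP) => [[i _ ->]|[i e]]; first by exists i.
have [lti|lei] := ltnP i k.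
  by exists (Ordinal lti) => //; apply: val_inj.
exists (Ordinal k0) => //; apply: val_inj.
by rewrite /= e rot_oversize ?size_tuple //= rot0.
Qed.

Lemma rotation_class_sub k (p p' : k.-tuple (arrow Q)) : (0 < k)%N ->
  p' \in rotation_class p -> rotation_class p = rotation_class p'.
Proof.
move=> k0 pp'.
have sub (r r' : k.-tuple (arrow Q)) :
    r' \in rotation_class r -> rotation_class r' \subset rotation_class r.
  case/(rotation_classP _ _ k0) => i e; apply/subsetP => x.
  case/(rotation_classP _ _ k0) => j xe; apply/(rotation_classP _ _ k0).
  by rewrite xe e rot_rot_add; eexists.
apply/eqP; rewrite eqEsubset (sub _ _ pp') andbT; apply: (sub).
case/(rotation_classP _ _ k0): pp' => i e; apply/(rotation_classP _ _ k0).
have [lti|lei] := ltnP i k; last first.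
  by exists 0%N; rewrite e rot0 rot_oversize ?size_tuple.
exists (k - i)%N; rewrite e -rotD ?size_tuple ?subnK ?(ltnW lti) //.
by rewrite rot_oversize ?size_tuple.
Qed.

Variable I : set (path_algebra K Q).
Local Notation Z := (zero_relation I).
Local Notation z := (znext Z).
Hypothesis Z_right : forall a b b', Z a b -> Z a b' -> b = b'.
Hypothesis Z_left : forall a a' b, Z a b -> Z a' b -> a = a'.
Variable D : {set arrow Q}.
Hypothesis D_trans : cycle_transversal Z [set a | cyclic Z a]%SET D.

Lemma zero_cycle_cyclic (p : seq (arrow Q)) a :
  cycle Z p -> a \in p -> cyclic Z a.
Proof.
move=> Zp ap; have [i p' e] := rot_to ap.
have : cycle Z (a :: p') by rewrite -e rot_cycle.
rewrite /= rcons_path => /andP[].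
case: p' {e} => [|b p'] /= Zp' Zl.
  by apply/existsP; exists a; rewrite Zl connect0.
case/andP: Zp' => Zab Zp'; apply/existsP; exists b; rewrite Zab /=.
by apply: connect_trans (connect1 Zl); apply/connectP; exists p'.
Qed.

Lemma zero_cycle_fcycle (p : seq (arrow Q)) : cycle Z p -> fcycle z p.
Proof.
move=> Zp; have cp := zero_cycle_cyclic Zp.
apply: (sub_in_cycle (P := mem p)) (Zp); last by apply/allP.
by move=> a b ap _ /(znext_eq Z_right (cp _ ap)) /= ->.
Qed.

Lemma orbit_zero_cycle c : cyclic Z c -> cycle Z (orbit z c).
Proof.
move=> cc; apply: (sub_in_cycle (P := cyclic Z) (e := frel z)).
- by move=> a b ca _ /eqP <-; apply: znextP.
- apply/allP => a; rewrite -fconnect_orbit => /iter_findex <-.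
  by rewrite (cyclic_iter Z_right).
- exact: cycle_orbit (znext_inj Z_right Z_left) c.
Qed.

(** A minimal zero cycle is the orbit of [znext] through any of its arrows,
    hence a rotation of the orbit of exactly one element of [D]. *)
Lemma card_cuts_of_order k : (0 < k)%N ->
  #|[set c in D | order z c == k]%SET| = num_minimal_zero_cycles I k.
Proof.
have [Dsub Dex Dun] := D_trans.
move=> k0; pose orb c : k.-tuple (arrow Q) :=
  [tuple of mkseq (fun i => iter i z c) k].
have orbE c : order z c = k -> orb c = orbit z c :> seq _.
  move=> ck; rewrite /orbit ck /= /mkseq; elim: k c {k0 orb ck} => // k IHk c /=.
  rewrite -IHk; congr cons; rewrite (iotaDl 1 0) -map_comp.
  by apply: eq_map => i /=; rewrite -iterSr.
rewrite -(card_in_imset (f := fun c => rotation_class (orb c))); last first.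
  move=> c c'; rewrite !inE => /andP[cD /eqP ck] /andP[c'D /eqP c'k] e.
  apply: Dun => //; rewrite fconnect_orbit -orbE //.
  have : orb c' \in rotation_class (orb c).
    by rewrite e; apply/rotation_classP => //; exists 0%N; rewrite rot0.
  case/(rotation_classP _ _ k0) => i ei; rewrite -(mem_rot i) -ei orbE //.
  exact: in_orbit.
apply: eq_card => C; apply/imsetP/imsetP => [[c]|[p]]; rewrite inE.
  move=> /andP[cD /eqP ck] ->; exists (orb c) => //.
  have cc : cyclic Z c by have := Dsub c cD; rewrite inE.
  by rewrite inE /minimal_zero_cycle orbE // orbit_uniq orbit_zero_cycle.
case/andP=> Zp up ->.
have p0 : exists a, a \in val p.
  by exists (tnth p (Ordinal k0)); apply: mem_tnth.
have [a ap] := p0; have fp := zero_cycle_fcycle Zp.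
have [|c cD ac] := Dex a; first by rewrite inE (zero_cycle_cyclic Zp ap).
have cp : c \in val p by rewrite -(fconnect_cycle fp ap).
have ck : order z c = k by rewrite (order_cycle fp up cp) size_tuple.
exists c; first by rewrite inE cD ck eqxx.
apply: rotation_class_sub => //; apply/rotation_classP => //.
by have [i e] := orbit_rot_cycle fp up cp; exists i; rewrite orbE.
Qed.

End CountingCycles.

(** * Ideals of path algebras *)

Lemma not_sorted_cat (A : eqType) (e : rel A) s x y t :
  ~~ e x y -> ~~ sorted e (s ++ [:: x, y & t]).
Proof.
move=> nxy; apply/negP; case: s => [|c s] /=; first by rewrite (negbTE nxy).
by rewrite cat_path /= (negbTE nxy) !andbF.
Qed.

Lemma not_sortedP (A : eqType) (e : rel A) s : ~~ sorted e s ->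
  exists s1 x y s2, s = s1 ++ [:: x, y & s2] /\ ~~ e x y.
Proof.
elim: s => [//|x [//|y s] IHs] /=; have [exy|nxy] := boolP (e x y); last first.
  by exists [::], x, y, s.
by move/IHs => [s1 [x1 [y1 [s2 [-> n]]]]]; exists (x :: s1), x1, y1, s2.
Qed.

Section Ideals.
Variables (K : fieldType) (Q : quiver).
Local Notation KQ := (path_algebra K Q).

Lemma sub_ideal_gen (S : set KQ) x : S x -> ideal_gen S x.
Proof. by move=> Sx A [_]; apply. Qed.

Lemma ideal_gen_min (S J : set KQ) :
  two_sided_ideal J -> (forall x, S x -> J x) -> forall x, ideal_gen S x -> J x.
Proof. by move=> iJ SJ x; apply; split. Qed.

Lemma ideal_gen_ideal (S : set KQ) : two_sided_ideal (ideal_gen S).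
Proof.
split=> [A [[]]//|x y Sx Sy A SA|a x b Sx A SA]; have [[A0 AD AM] _] := SA.
  by apply: AD; [apply: Sx|apply: Sy].
by apply: AM; apply: Sx.
Qed.

Section TwoSided.
Variable I : set KQ.
Hypothesis idI : two_sided_ideal I.

Lemma two_sided0 : I 0. Proof. by case: idI. Qed.

Lemma two_sidedD x y : I x -> I y -> I (x + y).
Proof. by case: idI => _ D _; apply: D. Qed.

Lemma two_sidedMl a x : I x -> I (a * x).
Proof. by case: idI => _ _ M Ix; rewrite -[a * x]mulr1; apply: M. Qed.

Lemma two_sidedMr x b : I x -> I (x * b).
Proof. by case: idI => _ _ M Ix; rewrite -[x]mul1r; apply: M. Qed.

Lemma two_sidedZ (c : K) x : I x -> I (c *: x).
Proof. by move=> Ix; rewrite -[x]mul1r pa_scalerAl; apply: two_sidedMl. Qed.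

Lemma two_sidedN x : I x -> I (- x).
Proof. by move=> Ix; rewrite -scaleN1r; apply: two_sidedZ. Qed.

Lemma two_sided_sum (J : Type) (r : seq J) (F : J -> KQ) :
  (forall j, I (F j)) -> I (\sum_(j <- r) F j).
Proof.
by move=> IF; apply: big_ind => //; [apply: two_sided0|apply: two_sidedD].
Qed.

(** Steinitz: modulo [I], an independent family in [V] is no longer than a
    spanning one, because its matrix of coordinates has independent rows. *)
Lemma independent_le_spanning (V : set KQ) n d (f : 'I_n -> KQ) (b : 'I_d -> KQ) :
  (forall i, V (f i)) ->
  (forall c : 'I_n -> K, I (\sum_i c i *: f i) -> forall i, c i = 0) ->
  (forall x, V x -> exists c : 'I_d -> K, I (x - \sum_i c i *: b i)) ->
  (n <= d)%N.
Proof.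
move=> Vf indf spanb.
have /choice[c cP] : forall i, exists c : 'I_d -> K, I (f i - \sum_j c j *: b j).
  by move=> i; apply: spanb.
pose M : 'M[K]_(n, d) := \matrix_(i, j) c i j.
suff /eqP <- : row_free M by apply: rank_leq_col.
rewrite -kermx_eq0; apply/eqP/row_matrixP => k; rewrite row0.
set u := row k _; have uM : u *m M = 0 by rewrite -row_mul mulmx_ker row0.
have u0 : forall i, u 0 i = 0.
  apply: indf.
  rewrite (_ : \sum_i _ = \sum_i u 0 i *: (f i - \sum_j c i j *: b j)).
    by apply: two_sided_sum => i; apply: two_sidedZ.
  under [RHS]eq_bigr do rewrite scalerBr.
  rewrite sumrB [X in _ - X](_ : _ = 0) ?subr0 //.
  under eq_bigr do rewrite scaler_sumr.
  rewrite exchange_big big1 // => j _.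
  under eq_bigr do rewrite scalerA.
  rewrite -scaler_suml; have /matrixP/(_ 0 j) := uM; rewrite !mxE => uMj.
  rewrite (_ : \sum_i _ = 0) ?scale0r // -[RHS]uMj.
  by apply: eq_bigr => i _; rewrite !mxE.
by apply/rowP => i; rewrite u0 mxE.
Qed.

Lemma quotient_dimE (V : set KQ) d (b : 'I_d -> KQ) :
  quotient_basis I V b -> quotient_dim I V = d.
Proof.
move=> bas; rewrite /quotient_dim; apply: xget_unique; first by exists b.
move=> d' [b' [Vb' ib' sb']]; case: bas => Vb ib sb.
apply/eqP; rewrite eqn_leq.
rewrite (independent_le_spanning Vb' ib' sb).
by rewrite (independent_le_spanning Vb ib sb').
Qed.

End TwoSided.

(** The elements [x] such that [h] vanishes on all products [a x b] form a
    two-sided ideal, and by linearity it is enough to take paths for [a], [b]. *)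
Lemma lin_ext_ideal_gen (V : lmodType K) (h : qpath Q -> V) (S : set KQ) :
  (forall x p q, S x -> lin_ext h (path_elt K p * x * path_elt K q) = 0) ->
  forall x, ideal_gen S x -> lin_ext h x = 0.
Proof.
move=> hS x; pose J : set KQ := fun x => forall a b, lin_ext h (a * x * b) = 0.
suff JS : ideal_gen S x -> J x by move/JS/(_ 1 1); rewrite mul1r mulr1.
apply: ideal_gen_min => [|{}x Sx].
  split=> [a b|y1 y2 J1 J2 a b|c y d Jy a b].
  - by rewrite mulr0 mul0r linear0.
  - by rewrite mulrDr mulrDl linearD /= J1 J2 addr0.
  - by rewrite !mulrA -(mulrA _ d); apply: Jy.
elim/pa_ind => [|c p a IHa] b; first by rewrite !mul0r linear0.
rewrite !mulrDl linearD /= IHa addr0 -!pa_scalerAl linearZ /=.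
suff -> : lin_ext h (path_elt K p * x * b) = 0 by rewrite scaler0.
elim/pa_ind: b => [|c' q b IHb]; first by rewrite mulr0 linear0.
by rewrite mulrDr linearD /= IHb addr0 -pa_scalerAr linearZ /= hS ?scaler0.
Qed.

(** Being [0] when the list is not a walk makes the multiplication rules
    below hold without side conditions. *)
Definition walk_elt (v : vertex Q) (s : seq (arrow Q)) : KQ :=
  oapp (@path_elt K Q) 0 (insub (v, s)).

Lemma walk_eltE (p : qpath Q) :
  path_elt K p = walk_elt (path_src p) (path_arrows p).
Proof.
by rewrite /walk_elt /path_src /path_arrows -surjective_pairing valK.
Qed.

Lemma walk_elt_path v s (h : is_walk v s) :
  walk_elt v s = path_elt K (@QPath Q (v, s) h).
Proof. by rewrite walk_eltE. Qed.

Lemma walk_elt0 v s : ~~ is_walk v s -> walk_elt v s = 0.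
Proof. by move=> h; rewrite /walk_elt insubN. Qed.

Lemma walk_elt_mul x s y t :
  walk_elt x s * walk_elt y t =
  if walk_end x s == y then walk_elt x (s ++ t) else 0.
Proof.
have [hs|hs] := boolP (is_walk x s); last first.
  rewrite (walk_elt0 hs) mul0r; case: eqP => // _.
  by rewrite walk_elt0 // is_walk_cat (negbTE hs).
have [ht|ht] := boolP (is_walk y t); last first.
  rewrite (walk_elt0 ht) mulr0; case: eqP => // e.
  by rewrite walk_elt0 // is_walk_cat e (negbTE ht) andbF.
rewrite (walk_elt_path hs) (walk_elt_path ht) [LHS]pa_mul_elt /path_mul /path_cat.
by rewrite /path_tgt /path_src /path_arrows /=; case: ifP.
Qed.

Lemma arrow_eltE a : arrow_elt K a = walk_elt (src a) [:: a].
Proof. by rewrite /arrow_elt walk_eltE. Qed.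

Lemma idem_eltE v : idem_elt K v = walk_elt v [::].
Proof. by rewrite /idem_elt walk_eltE. Qed.

Lemma walk_elt_cons a s :
  walk_elt (src a) (a :: s) = arrow_elt K a * walk_elt (tgt a) s.
Proof. by rewrite arrow_eltE walk_elt_mul /walk_end /= eqxx. Qed.

Lemma arrow_mulE a b : tgt a = src b ->
  arrow_elt K a * arrow_elt K b = walk_elt (src a) [:: a; b].
Proof. by move=> e; rewrite !arrow_eltE walk_elt_mul /walk_end /= e eqxx. Qed.

Lemma walk_elt_sandwich x s a b y t : tgt a = src b ->
  walk_elt x s * (arrow_elt K a * arrow_elt K b) * walk_elt y t =
  if (walk_end x s == src a) && (tgt b == y) then walk_elt x (s ++ [:: a, b & t])
  else 0.
Proof.
move=> ab; rewrite !arrow_eltE walk_elt_mul /= -ab /walk_end /= eqxx.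
rewrite walk_elt_mul -/(walk_end x s); case: ifP => xa; last by rewrite mul0r.
by rewrite walk_elt_mul walk_end_cat /walk_end /= -catA.
Qed.

Lemma lin_ext_walk_elt (h : vertex Q -> seq (arrow Q) -> K^o) x s :
  lin_ext (fun p => h (path_src p) (path_arrows p)) (walk_elt x s) =
  if is_walk x s then h x s else 0.
Proof.
case: ifPn => hs; last by rewrite walk_elt0 // linear0.
by rewrite (walk_elt_path hs) lin_ext_elt.
Qed.

End Ideals.

(** * Special loops *)

Section SpecialLoops.
Variables (K : fieldType) (Q : quiver) (Sp : {set vertex Q}).
Variable I : set (path_algebra K Q).
Local Notation Qsp := (sp_quiver Sp).
Local Notation J := (sp_ideal Sp I).
Local Notation Z := (zero_relation I).

(** The relation [T]: a pair through a special vertex counts as nonzero even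
    though it is a zero relation of [I], since the zero relations at special
    vertices become commutation relations of the hat algebra. *)
Definition nonzero_pair : rel (arrow Q) :=
  fun a b => (src b == tgt a) && ((tgt a \in Sp) || ~~ Z a b).

Definition sp_nonzero_pair : rel (arrow Qsp) := fun x y =>
  match x, y with
  | inl a, inl b => ~~ Z a b
  | inr u, inr v => u != v
  | _, _ => true
  end.

(** The ideal is monomial: a path without relation has coefficient [0] in all
    its elements. *)
Lemma sp_ideal_coef (v : vertex Q) (w : seq (arrow Qsp)) x :
  sorted sp_nonzero_pair w -> J x ->
  lin_ext (fun p : qpath Qsp =>
    ((path_src p == v) && (path_arrows p == w))%:R : K^o) x = 0.
Proof.
move=> sw; apply: lin_ext_ideal_gen => {}x p q Sx.
pose h (u : vertex Qsp) (s : seq (arrow Qsp)) : K^o := ((u == v) && (s == w))%:R.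
suff [A [B [AB nAB ->]]] : exists A B : arrow Qsp,
    [/\ tgt A = src B, ~~ sp_nonzero_pair A B
      & x = arrow_elt K A * arrow_elt K B].
  rewrite !walk_eltE walk_elt_sandwich //.
  case: ifP => _; last by rewrite linear0.
  rewrite (lin_ext_walk_elt h); case: ifP => // _; rewrite /h.
  case: (_ =P w) => [e|]; last by rewrite andbF.
  by have := not_sorted_cat (path_arrows p) (path_arrows q) nAB; rewrite e sw.
case: Sx => [[a [b [ab Iab ->]]]|[u _ <-]].
  exists (inl a), (inl b); split=> //=; rewrite negbK /zero_relation ab eqxx.
  exact/asboolP.
by exists (inr u), (inr u); split=> //=; rewrite ?eqxx // expr2.
Qed.

Lemma sp_ideal_walk v (w : seq (arrow Qsp)) : is_walk v w ->
  sorted sp_nonzero_pair w -> ~ J (walk_elt K v w).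
Proof.
move=> hw sw /(sp_ideal_coef v sw).
pose h (u : vertex Qsp) (s : seq (arrow Qsp)) : K^o := ((u == v) && (s == w))%:R.
by rewrite (lin_ext_walk_elt h) hw /h !eqxx => /eqP; rewrite oner_eq0.
Qed.

Hypothesis gJ : gentle J.

(** If [ab] were not a zero relation, [a] could be followed in the quiver with
    loops both by [b] and by the special loop. *)
Lemma special_zero_relation a b :
  tgt a \in Sp -> src b = tgt a -> Z a b.
Proof.
move=> aSp sb; apply/negPn/negP => nZ.
pose e : arrow Qsp := inr (exist _ (tgt a) aSp).
suff : inl b = e by [].
apply: (gentle_nonzero_right gJ (a := inl a)); rewrite arrow_mulE //.
  by apply: sp_ideal_walk; rewrite /= ?sb ?eqxx ?nZ.
by apply: sp_ideal_walk; rewrite /= ?eqxx.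
Qed.

(** Besides the special loop there is room for one arrow in each direction. *)
Lemma special_valency a b :
  tgt a \in Sp -> src b = tgt a -> valency (tgt a) = 2%N.
Proof.
move=> aSp sb; pose e : arrow Qsp := inr (exist _ (tgt a) aSp).
have one (A : pred (arrow Q)) (B : pred (arrow Qsp)) c :
    (#|B| <= 2)%N -> (forall c, A c -> B (inl c)) -> B e -> A c -> #|A| = 1%N.
  move=> B2 AB Be Ac; rewrite (eq_card (B := pred1 c)) ?card1 // => c'.
  apply/idP/eqP => [Ac'|->//]; apply/eqP; apply: contraTT B2 => ne.
  rewrite -ltnNge; apply/card_gt2P; exists (inl c'), (inl c), e.
  by split; split; rewrite ?unfold_in; auto.
rewrite /valency (one _ [pred x : arrow Qsp | tgt x == tgt a] a) ?inE //=.
- rewrite (one _ [pred x : arrow Qsp | src x == tgt a] b) ?inE ?sb ?eqxx //=.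
  exact: (gentle_out gJ (tgt a)).
- exact: (gentle_in gJ (tgt a)).
Qed.

Hypothesis fJ : finite_dim_quotient J.

(** The loops turn a [nonzero_pair]-walk into a path without relation. *)
Fixpoint insert_loops (p : seq (arrow Q)) : seq (arrow Qsp) :=
  if p is b :: p' then
    if insub (src b) is Some v then [:: inr v, inl b & insert_loops p']
    else inl b :: insert_loops p'
  else [::].

Lemma insert_loops_walk a p : path nonzero_pair a p ->
  [/\ is_walk (tgt a : vertex Qsp) (insert_loops p),
      path sp_nonzero_pair (inl a) (insert_loops p) &
      (size p <= size (insert_loops p))%N].
Proof.
elim: p a => [//|b p IHp] a /= /andP[/andP[/eqP sb nab] /IHp[wp pp sp]].
case: insubP => [v _ ve|nSp] /=; rewrite ?ve sb ?eqxx wp pp ?ltnS.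
  by split=> //; apply: leq_trans sp _.
by move: nab; rewrite -sb (negbTE nSp) /= => ->.
Qed.

(** The initial segments of the path with loops inserted are linearly
    independent modulo the ideal, so their number is at most the dimension. *)
Lemma nonzero_pair_bounded : exists N, forall a p,
  path nonzero_pair a p -> (size p < N)%N.
Proof.
have idJ : two_sided_ideal J by apply: ideal_gen_ideal.
have [d [f [_ _ spanf]]] := fJ; exists d => a p /insert_loops_walk[wp pp sp].
pose s : seq (arrow Qsp) := inl a :: insert_loops p.
apply: leq_trans (_ : (size s <= d)%N) => //.
pose g (i : 'I_(size s)) := walk_elt K (src a : vertex Qsp) (take i s).
apply: (independent_le_spanning idJ (f := g) _ _ spanf) => // c Jc i.
have ss : sorted sp_nonzero_pair (take i s) by apply: take_sorted.
have ws j : is_walk (src a : vertex Qsp) (take j s).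
  have : is_walk (src a : vertex Qsp) s by rewrite /= eqxx.
  by rewrite -{1}(cat_take_drop j s) is_walk_cat => /andP[].
have := sp_ideal_coef (src a) ss Jc.
pose h (u : vertex Qsp) (t : seq (arrow Qsp)) : K^o :=
  ((u == src a) && (t == take i s))%:R.
rewrite linear_sum (bigD1 i) //= linearZ /= (lin_ext_walk_elt h) ws /h !eqxx.
rewrite big1 ?addr0 => [<-|j ji]; first by rewrite [RHS]mulr1.
rewrite linearZ /= (lin_ext_walk_elt h) ws /h.
suff /negbTE-> : take j s != take i s by rewrite andbF scaler0.
apply: contraNneq ji => /(congr1 size); rewrite !size_takel 1?ltnW //.
by move/val_inj->.
Qed.

End SpecialLoops.

(** * The hat algebra *)

Section HatAlgebra.
Variables (K : fieldType) (Q : quiver) (Sp : {set vertex Q}).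
Variable I : set (path_algebra K Q).
Local Notation Qh := (hat_quiver Sp).
Local Notation J := (hat_ideal Sp I).
Local Notation Z := (zero_relation I).
Local Notation T := (nonzero_pair Sp I).
Local Notation below := (@below_vertex Q Sp).
Local Notation under := (map (@below_arrow Q Sp)).

Hypothesis special_zero : forall a b, tgt a \in Sp -> src b = tgt a -> Z a b.
Hypothesis special_val : forall a b, tgt a \in Sp -> src b = tgt a ->
  valency (tgt a) = 2%N.

Let idJ : two_sided_ideal J := ideal_gen_ideal _.

Lemma below_src (A : arrow Qh) : below (src A) = src (below_arrow A).
Proof. by have /andP[/eqP ? _] := valP A. Qed.

Lemma below_tgt (A : arrow Qh) : below (tgt A) = tgt (below_arrow A).
Proof. by have /andP[_ /eqP ?] := valP A. Qed.

Lemma hat_arrow_inj (A B : arrow Qh) :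
  src A = src B -> tgt A = tgt B -> below_arrow A = below_arrow B -> A = B.
Proof.
move=> es et eb; apply: val_inj; move: es et eb; rewrite /below_arrow /=.
by case: (val A) (val B) => [a [x y]] [b [x' y']] /= -> -> ->.
Qed.

Lemma hat_arrow_over a (x y : vertex Qh) : below x = src a -> below y = tgt a ->
  exists A : arrow Qh, [/\ src A = x, tgt A = y & below_arrow A = a].
Proof.
move=> ex ey.
have h : (below x == src a) && (below y == tgt a) by rewrite ex ey !eqxx.
by exists (exist _ (a, (x, y)) h).
Qed.

Lemma below_surj v : exists x : vertex Qh, below x == v.
Proof.
have [vS|vS] := boolP (v \in Sp).
  by exists (inr (exist _ v vS, true)) => /=.
by exists (inl (exist _ v vS)) => /=.
Qed.

Lemma fibre_card v : #|[pred x : vertex Qh | below x == v]| = (v \in Sp).+1.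
Proof.
have [vS|vS] := boolP (v \in Sp).
  rewrite (eq_card
    (B := pred2 (inr (exist _ v vS, true)) (inr (exist _ v vS, false)))).
    by rewrite card2; case: eqP => // -[].
  move=> [[u uS]|[[u uS] e]]; rewrite !inE /=.
    by apply/negP => /eqP uv; rewrite uv vS in uS.
  apply/eqP/orP => [uv|[]/eqP[]//].
  subst u; rewrite (bool_irrelevance uS vS).
  by case: e; rewrite eqxx; [left|right].
rewrite (eq_card (B := pred1 (inl (exist _ v vS)))) ?card1 //.
move=> [[u uS]|[[u uS] e]]; rewrite !inE /=; last first.
  by apply/negP => /eqP uv; rewrite uv (negbTE vS) in uS.
by apply/eqP/eqP => [uv|[]//]; subst u; rewrite (bool_irrelevance uS vS).
Qed.

Lemma nonzero_zero_fibre a b : (T a b + Z a b)%N =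
  ((src b == tgt a) * #|[pred x : vertex Qh | below x == tgt a]|)%N.
Proof.
rewrite fibre_card /nonzero_pair; case: eqP => [sb|nsb]; last first.
  by rewrite /zero_relation; case: eqP => // /esym.
case: (boolP (tgt a \in Sp)) => [aS|_]; first by rewrite special_zero.
by case: (Z a b).
Qed.

Lemma below_eq (x y : vertex Qh) : below x = below y -> x != y ->
  exists v e, x = inr (v, e) /\ y = inr (v, ~~ e).
Proof.
case: x y => [x|[x e]] [y|[y f]] /= exy; rewrite ?(val_inj exy) ?eqxx //.
- by move: (valP x) (valP y) => /=; rewrite exy => /negbTE->.
- by move: (valP y) (valP x) => /=; rewrite -exy => /negbTE->.
move=> ne; exists x, e; rewrite -(val_inj exy) in ne *.
split=> //; congr (inr (_, _)).
by case: e f ne => [] []; rewrite ?eqxx.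
Qed.

Lemma walk_vanishes x (s : seq (arrow Qh)) :
  ~~ sorted T (under s) -> J (walk_elt K x s).
Proof.
move=> ns; have [hs|/walk_elt0->] := boolP (is_walk x s); last first.
  exact: (two_sided0 idJ).
have : ~~ sorted (relpre (@below_arrow Q Sp) T) s by rewrite -sorted_map.
case/not_sortedP=> s1 [A [B [s2 [es nAB]]]].
move: hs; rewrite es is_walk_cat /= => /and3P[_ /eqP sA /andP[/eqP sB _]].
have {}sB : tgt (A : arrow Qh) = src (B : arrow Qh) := esym sB.
have {}sA : walk_end x s1 = src (A : arrow Qh) := esym sA.
have := walk_elt_sandwich K x s1 (tgt (B : arrow Qh)) s2 sB.
rewrite sA !eqxx /= => <-.
apply: (two_sidedMr idJ); apply: (two_sidedMl idJ); apply: sub_ideal_gen; left.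
move: nAB; rewrite /relpre /= /nonzero_pair -below_src -below_tgt sB eqxx /=.
rewrite negb_or negbK => /andP[nS /andP[/eqP AB /asboolP IAB]].
by exists A, B; split=> //; rewrite -below_tgt sB.
Qed.

(** A path is determined modulo the mesh relations by its end points and the
    walk below it: the copies of the special vertices on its way can be
    exchanged one after the other. *)
Lemma walk_congruent x (s s' : seq (arrow Qh)) : is_walk x s -> is_walk x s' ->
  under s = under s' -> walk_end x s = walk_end x s' ->
  J (walk_elt K x s - walk_elt K x s').
Proof.
elim: s s' x => [|A s IHs] [|A' s'] x //=.
  by rewrite subrr => *; apply: (two_sided0 idJ).
move=> /andP[/eqP sA hs] /andP[/eqP sA' hs'] [eA es] ee.
have {}sA : src (A : arrow Qh) = x := sA.
have {}sA' : src (A' : arrow Qh) = x := sA'.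
have {}hs : is_walk (tgt (A : arrow Qh)) s := hs.
have {}hs' : is_walk (tgt (A' : arrow Qh)) s' := hs'.
have {}ee : walk_end (tgt (A : arrow Qh)) s = walk_end (tgt (A' : arrow Qh)) s'.
  by [].
have step B r : is_walk (tgt A) (B :: r) -> under (B :: r) = under s ->
    walk_end (tgt A) (B :: r) = walk_end (tgt A) s ->
    J (walk_elt K x (A :: s) - walk_elt K x (A :: B :: r)).
  move=> h1 h2 h3; rewrite -sA !(walk_elt_cons K A) -mulrBr.
  apply: (two_sidedMl idJ).
  by apply: IHs.
have [et|nt] := eqVneq (tgt A) (tgt A').
  have AA' : A = A' by apply: hat_arrow_inj; rewrite ?sA ?sA'.
  subst A'; rewrite -sA !walk_elt_cons -mulrBr; apply: (two_sidedMl idJ).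
  exact: IHs.
have [v [e [tA tA']]] : exists v e, tgt A = inr (v, e) /\ tgt A' = inr (v, ~~ e).
  by apply: below_eq => //; rewrite !below_tgt eA.
case: s' es hs' ee => [|B' r].
  by case: s {IHs step hs} => // _ _ /= /eqP; rewrite (negbTE nt).
move=> es hs' ee.
have sB' : src (B' : arrow Qh) = tgt (A' : arrow Qh) by case/andP: hs' => /eqP.
have hr : is_walk (tgt (B' : arrow Qh)) r by case/andP: hs'.
have bB' : below (tgt A) = src (below_arrow B').
  by rewrite -below_src sB' !below_tgt eA.
(* [B''] follows [A] as [B'] follows [A']: the mesh relation exchanges the two *)
have [B'' [sB'' tB'' eB'']] := hat_arrow_over bB' (below_tgt B').
rewrite -[X in J X](subrKA (walk_elt K x (A :: B'' :: r))).
apply: (two_sidedD idJ).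
  apply: step.
  - by apply/andP; rewrite sB'' tB'' eqxx.
  - by rewrite es /= eB''.
  - by rewrite ee -[LHS]/(walk_end (tgt B'') r) tB''.
rewrite -{1}sA -sA' walk_elt_cons -sB'' walk_elt_cons.
rewrite walk_elt_cons -sB' walk_elt_cons.
rewrite tB'' !mulrA -mulrBl; apply: (two_sidedMr idJ).
have vS : tgt (below_arrow A) \in Sp by rewrite -below_tgt tA /= (valP v).
have vE : tgt (below_arrow A) = val v by rewrite -below_tgt tA.
have sbB : src (below_arrow B') = val v by rewrite -below_src sB' tA'.
have mesh (C D C' D' : arrow Qh) :
    below_arrow C = below_arrow A -> below_arrow D = below_arrow B' ->
    below_arrow C' = below_arrow A -> below_arrow D' = below_arrow B' ->
    tgt C = inr (v, true) -> src D = inr (v, true) ->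
    tgt C' = inr (v, false) -> src D' = inr (v, false) ->
    src C = src C' -> tgt D = tgt D' ->
    J (arrow_elt K C * arrow_elt K D - arrow_elt K C' * arrow_elt K D').
  move=> *; apply: sub_ideal_gen; right.
  exists v, (below_arrow A), (below_arrow B'), C, D, C', D'.
  split=> //; split=> //.
    by rewrite -vE; apply: (@special_val _ (below_arrow B') vS); rewrite sbB vE.
  have : Z (below_arrow A) (below_arrow B').
    by apply: (special_zero vS); rewrite sbB vE.
  by case/andP => _ /asboolP.
case: e tA tA' => tA tA'.
  by apply: mesh; rewrite ?sB'' ?tA ?sB' ?tA' ?sA.
rewrite -opprB; apply: (two_sidedN idJ).
by apply: mesh; rewrite ?sB'' ?tA ?sB' ?tA' ?sA.
Qed.

(** Summing the coefficients of the paths from [x] to [y] over a [T]-walk [w]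
    gives a linear form on the hat algebra: mesh relations cancel in it, and
    zero relations only occur in paths over other walks. *)
Definition over_form (x y : vertex Qh) (w : seq (arrow Q)) (p : qpath Qh) : K^o :=
  [&& path_src p == x, walk_end (path_src p) (path_arrows p) == y
    & under (path_arrows p) == w]%:R.

Lemma over_form_walk x y w u (s : seq (arrow Qh)) :
  lin_ext (over_form x y w) (walk_elt K u s) =
  [&& is_walk u s, u == x, walk_end u s == y & under s == w]%:R.
Proof.
pose h (u : vertex Qh) (s : seq (arrow Qh)) : K^o :=
  [&& u == x, walk_end u s == y & under s == w]%:R.
by rewrite (lin_ext_walk_elt h); case: ifP.
Qed.

Lemma over_form_ideal x y w z : sorted T w -> J z ->
  lin_ext (over_form x y w) z = 0.
Proof.
move=> sw; apply: lin_ext_ideal_gen => {}z p q; rewrite !walk_eltE => -[].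
  case=> A [B [ab Iab nS AB ->]]; rewrite walk_elt_sandwich //.
  case: ifP => _; last by rewrite linear0.
  rewrite over_form_walk; case: (_ =P w) => [e|]; last by rewrite !andbF.
  have nT : ~~ T (below_arrow A) (below_arrow B).
    rewrite /nonzero_pair (negbTE nS) /= /zero_relation ab eqxx /=.
    by rewrite negbK; apply/asboolP.
  have := not_sorted_cat (under (path_arrows p)) (under (path_arrows q)) nT.
  by rewrite -e map_cat /= in sw; rewrite sw.
case=> v [a [b [A [B [A' [B' [_ [eA eB tA sB] [eA' eB' tA' sB'] [ss tt] ->]]]]]]].
rewrite mulrBr mulrBl linearB /= !walk_elt_sandwich ?tA ?tA' //.
rewrite ss tt; case: ifP => _; last by rewrite linear0 subrr.
apply/eqP; rewrite subr_eq0 !over_form_walk !map_cat /= eA eA' eB eB'.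
rewrite !is_walk_cat !walk_end_cat /walk_end /=.
move: ss tt sB sB' tA tA' => /= ss tt sB sB' tA tA'.
by rewrite ss sB sB' tA tA' tt.
Qed.

(** The [T]-walks of length [n] below the paths from [x] to [y]; the empty walk
    only lifts to trivial paths, so it needs [x = y]. *)
Definition hat_walks n (x y : vertex Qh) : seq (seq (arrow Q)) :=
  if n is n'.+1
  then flatten [seq [seq a :: p | p <- walks (@tgt Q) T n' a (below y)]
               | a <- enum (arrow Q) & src a == below x]
  else if x == y then [:: [::]] else [::].


Lemma walk_lift a (w : seq (arrow Q)) (x y : vertex Qh) : path T a w ->
  src a = below x -> tgt (last a w) = below y ->
  exists s : seq (arrow Qh),
    [/\ is_walk x s, walk_end x s = y & under s = a :: w].
Proof.
elim: w a x => [|b w IHw] a x /=.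
  move=> _ ax ay; have [A [sA tA eA]] := hat_arrow_over (esym ax) (esym ay).
  by exists [:: A]; split=> //=; rewrite ?eA // andbT; apply/eqP.
move=> /andP[/andP[/eqP sb _] Tw] ax by_.
have [v /eqP ve] := below_surj (tgt a).
have [s [hs es us]] := IHw b v Tw (etrans sb (esym ve)) by_.
have [A [sA tA eA]] := hat_arrow_over (esym ax) ve.
exists (A :: s); split; last by rewrite /= eA us.
  by apply/andP; rewrite sA tA eqxx.
by rewrite -es -tA.
Qed.

Lemma hat_walks_lift n x y w : w \in hat_walks n x y ->
  sorted T w /\ exists s : seq (arrow Qh),
    [/\ is_walk x s, walk_end x s = y, under s = w & size s = n].
Proof.
case: n => [|n] /=.
  case: eqP => // ->; rewrite inE => /eqP ->; split=> //.
  by exists [::].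
case/flatten_mapP => a; rewrite mem_filter => /andP[/eqP ax _].
case/mapP => p; rewrite mem_walks => /and3P[/eqP sp Tp /eqP tp] ->; split=> //.
have [s [hs es us]] := walk_lift Tp ax tp; exists s; split=> //.
by rewrite -(size_map (@below_arrow Q Sp)) us /= sp.
Qed.

Lemma hat_walks_complete x (s : seq (arrow Qh)) : is_walk x s ->
  sorted T (under s) -> under s \in hat_walks (size s) x (walk_end x s).
Proof.
case: s => [|A s]; first by rewrite /= /walk_end /= eqxx inE.
move=> hs Ts; have /andP[/eqP sA {}hs] := hs.
apply/flatten_mapP; exists (below_arrow A).
  by rewrite mem_filter mem_enum -sA -below_src eqxx.
apply/mapP; exists (under s) => //; rewrite mem_walks size_map eqxx andTb.
apply/andP; split; first exact: Ts.
apply/eqP; rewrite -[walk_end _ _]/(walk_end (tgt A) s).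
elim: s A {sA hs Ts} => [|B s IHs] A; first by rewrite /walk_end /= -below_tgt.
exact: IHs.
Qed.

Lemma hat_walks_uniq n x y : uniq (hat_walks n x y).
Proof.
case: n => [|n] /=; first by case: ifP.
by apply: flatten_cons_uniq; rewrite ?enum_uniq // => a; apply: walks_uniq.
Qed.

Lemma idem_walk_idem x y u (s : seq (arrow Qh)) :
  idem_elt K x * walk_elt K u s * idem_elt K y =
  if (u == x) && (walk_end u s == y) then walk_elt K u s else 0.
Proof.
rewrite !idem_eltE walk_elt_mul /walk_end /= eq_sym; case: eqP => [->|_] /=.
  by rewrite walk_elt_mul cats0.
by rewrite mul0r.
Qed.

Lemma hat_quotient_basis n x y :
  exists b : 'I_(size (hat_walks n x y)) -> path_algebra K Qh,
    quotient_basis J (@corner_part K Qh x y n) b.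
Proof.
set W := hat_walks n x y; pose w (i : 'I_(size W)) := nth [::] W i.
have wW i : w i \in W by apply: mem_nth.
have /choice[f fP] : forall i, exists s : seq (arrow Qh),
    [/\ is_walk x s, walk_end x s = y, under s = w i & size s = n].
  by move=> i; have [] := hat_walks_lift (wW i).
have wT i : sorted T (w i) by have [] := hat_walks_lift (wW i).
have w_inj i j : w i = w j -> i = j.
  move=> e; apply/val_inj/eqP.
  rewrite -(nth_uniq [::] (ltn_ord i) (ltn_ord j)) ?hat_walks_uniq //.
  exact/eqP.
exists (fun i => walk_elt K x (f i)); split=> [i|c Jc i|_ [u hu <-]].
- have [hf ef uf sf] := fP i; exists (walk_elt K x (f i)).
    move=> p; rewrite (walk_elt_path K hf) => /(fsubsetP msuppU_le).
    by move=> /fset1P ->.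
  by rewrite idem_walk_idem ef !eqxx.
- have := over_form_ideal x y (wT i) Jc.
  rewrite linear_sum (bigD1 i) //= linearZ /= over_form_walk.
  have [-> -> -> _] := fP i; rewrite !eqxx /= big1 => [|j ji].
    by rewrite addr0 => <-; rewrite [RHS]mulr1.
  rewrite linearZ /= over_form_walk; have [_ _ -> _] := fP j.
  suff /negbTE-> : w j != w i by rewrite !andbF scaler0.
  by apply: contraNneq ji => /w_inj->.
pose span z := exists c : 'I_(size W) -> K,
  J (z - \sum_i c i *: walk_elt K x (f i)).
rewrite [u]path_algebra_basis mulr_sumr mulr_suml big_seq.
change (span (\sum_(p <- msupp u | p \in msupp u)
  idem_elt K x * (u@_p *: path_elt K p) * idem_elt K y)).
have span0 z : J z -> span z.
  move=> Jz; exists (fun=> 0); rewrite big1 ?subr0 // => i _.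
  by rewrite scale0r.
elim/big_ind: _ => [|z1 z2 [c1 J1] [c2 J2]|p pu].
- by apply: span0; apply: (two_sided0 idJ).
- exists (fun i => c1 i + c2 i); under eq_bigr do rewrite scalerDl.
  by rewrite big_split /= opprD addrACA; apply: (two_sidedD idJ).
rewrite -pa_scalerAr -pa_scalerAl walk_eltE idem_walk_idem.
case: ifP => [/andP[/eqP px /eqP py]|_]; last first.
  by apply: span0; rewrite scaler0; apply: (two_sided0 idJ).
have hp : is_walk x (path_arrows p) by rewrite -px; apply: (valP p).
rewrite px in py *.
have [Tp|nTp] := boolP (sorted T (under (path_arrows p))); last first.
  by apply: span0; apply: (two_sidedZ idJ); apply: walk_vanishes.
have := hat_walks_complete hp Tp.
rewrite py -/(path_length p) (hu p pu) -/W => pW.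
have [i iE] : exists i, w i = under (path_arrows p).
  have lt : (index (under (path_arrows p)) W < size W)%N by rewrite index_mem.
  by exists (Ordinal lt); rewrite /w /= nth_index.
exists (fun j => if j == i then u@_p else 0).
rewrite (bigD1 i) //= eqxx big1 ?addr0 => [|j /negbTE->]; last by rewrite scale0r.
rewrite -scalerBr; apply: (two_sidedZ idJ); have [hf ef uf _] := fP i.
by apply: walk_congruent; rewrite ?uf ?ef ?iE ?py.
Qed.

Lemma cartan_poly_hat N x y :
  (forall a p, path T a p -> (size p < N)%N) ->
  cartan_poly J x y = cartan_entry (@src Q) (@tgt Q) below T N x y.
Proof.
move=> TN; rewrite /cartan_poly; set c := cartan_entry _ _ _ _ _ _ _.
have cE n : c`_n = (quotient_dim J (@corner_part K Qh x y n))%:Z.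
  have [b /(quotient_dimE idJ) ->] := hat_quotient_basis n x y.
  rewrite /c /cartan_entry coefD coef_sum coefMn coef1.
  under eq_bigr do rewrite (coef_walk_poly _ TN).
  case: n {b} => [|n]; first by rewrite big1 // addr0 /=; case: eqP.
  rewrite mul0rn add0r /= size_flatten sumnE !big_map big_filter big_enum_cond.
  rewrite -natr_sum natz; congr (Posz _); apply: eq_big => // a _.
  by rewrite size_map.
apply: xget_unique => // c' c'E; apply/polyP => n.
by rewrite cE c'E.
Qed.

End HatAlgebra.

(** * The main theorem *)

Local Open Scope classical_set_scope.

Theorem theorem2 (K : fieldType) (Q : quiver) (I : set (path_algebra K Q))
    (Sp : {set vertex Q})
    (I_gentle : gentle I) (I_fin : finite_dim_quotient I)
    (Sp_admissible : admissible_special Sp I) :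
  exists d : 'rV[{poly int}]_#|vertex (hat_quiver Sp)|,
    [/\ unimodularly_equivalent (q_cartan_matrix (hat_ideal Sp I)) (diag_mx d),
        forall k, (0 < k)%N ->
          #|[set i | d ord0 i == 1 - (- 'X) ^+ k]%SET| =
            num_minimal_zero_cycles I k
      & forall i, d ord0 i = 1 \/
          exists2 k, (0 < k)%N & d ord0 i = 1 - (- 'X) ^+ k].
Proof.
have [gJ fJ] := Sp_admissible.
(* gentleness makes the zero relations a partial injection *)
have Z_right a b b' : zero_relation I a b -> zero_relation I a b' -> b = b'.
  move=> /andP[/eqP ab /asboolP Iab] /andP[/eqP ab' /asboolP Iab'].
  exact: (gentle_zero_right I_gentle) Iab _ Iab'.
have Z_left a a' b : zero_relation I a b -> zero_relation I a' b -> a = a'.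
  move=> /andP[/eqP ab /asboolP Iab] /andP[/eqP ab' /asboolP Iab'].
  exact: (gentle_zero_left I_gentle) Iab _ Iab'.
have Sp_zero := special_zero_relation gJ.
have Sp_val := special_valency gJ.
have [N TN] := nonzero_pair_bounded fJ.
have [D [d [D_trans eqv cnt val_d]]] :=
  cartan_diagonalization (nonzero_zero_fibre Sp_zero) Z_right Z_left
    (@below_surj _ Sp) TN.
exists (\row_i d (enum_val i)); split=> [|k k0|i]; last by rewrite mxE.
  pose W := vertex (hat_quiver Sp).
  suff -> : q_cartan_matrix (hat_ideal Sp I) = @mxf _ W W (cartan_entry
    (@src Q) (@tgt Q) (@below_vertex Q Sp) (nonzero_pair Sp I) N) by exact: eqv.
  by apply/matrixP => i j; rewrite !mxE (cartan_poly_hat Sp_zero Sp_val _ _ TN).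
rewrite -(card_cuts_of_order Z_right Z_left D_trans k0) -cnt //.
rewrite -(card_imset _ enum_val_inj); apply: eq_card => x.
apply/imsetP/idP => [[i]|].
  by rewrite !inE mxE => h ->; exact: h.
by rewrite inE => dx; exists (enum_rank x); rewrite ?inE ?mxE enum_rankK.
Qed.
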